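(* Let $s\in(0,1)$ and $p>1$ be such that $sp=1$. There exists $\alpha_*=\alpha_*(s)>0$, depending only on $s$, such that for every nonempty bounded open interval $I\subset\mathbb{R}$ and every $\alpha\in[0,\alpha_* )$, $$\sup_{u\in\tilde W^{s,p}_0(I),\ [u]_{W^{s,p}(\mathbb{R})}\le 1}\ \int_I e^{\alpha|u|^{\frac{1}{1-s}}}\,dx<\infty .$$ Moreover, setting $\alpha^*=\alpha^*(s):=\gamma_s^{\frac{s}{1-s}}$, where $$\gamma_s:=8\,\Gamma(p+1)\sum_{k=0}^\infty\frac{1}{(1+2k)^p},$$ for every nonempty bounded open interval $I\subset\mathbb{R}$ and every $\alpha\in(\alpha^*,+\infty)$, $$\sup_{u\in\tilde W^{s,p}_0(I),\ [u]_{W^{s,p}(\mathbb{R})}\le 1}\ \int_I e^{\alpha|u|^{\frac{1}{1-s}}}\,dx=+\infty .$$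
   Context: Let $s\in(0,1)$, $p>1$ with $sp=1$. For a real-valued measurable $u$ on $\mathbb{R}$, the Gagliardo seminorm is $$[u]_{W^{s,p}(\mathbb{R})}:=\left(\int_{\mathbb{R}}\int_{\mathbb{R}}\frac{|u(x)-u(y)|^p}{|x-y|^2}\,dx\,dy\right)^{1/p},$$ the Sobolev-Slobodeckij space is $W^{s,p}(\mathbb{R}):=\{u\in L^p(\mathbb{R}) : [u]_{W^{s,p}(\mathbb{R})}<+\infty\}$, and its norm is $\|u\|_{W^{s,p}(\mathbb{R})}:=\left(\|u\|_{L^p(\mathbb{R})}^p+[u]_{W^{s,p}(\mathbb{R})}^p\right)^{1/p}$. For an open interval $I\subset\mathbb{R}$, $\tilde W^{s,p}_0(I)$ denotes the closure of $C^\infty_0(I)$ (smooth functions with compact support in $I$, extended by $0$ to $\mathbb{R}$) in $W^{s,p}(\mathbb{R})$ with respect to the norm $\|\cdot\|_{W^{s,p}(\mathbb{R})}$. $\Gamma$ is the Euler Gamma function. *)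

(* Defs.v *)
From HB Require Import structures.
From mathcomp Require Import all_boot all_order all_algebra.
From mathcomp Require Import all_classical all_reals all_analysis.
Set Implicit Arguments.
Unset Strict Implicit.
Unset Printing Implicit Defensive.
Import Order.TTheory GRing.Theory Num.Theory.
Import numFieldNormedType.Exports.
Local Open Scope classical_set_scope.
Local Open Scope ring_scope.

(* Functions R -> R are measurable for the Borel sigma-algebra; every
   Lebesgue-measurable function agrees a.e. with a Borel one, and all the
   quantities below depend only on the a.e. class of the function. *)

(* Seminorm of W^{s,p}(R) in the critical case s * p = 1, where the kernel
   exponent 1 + s * p is 2. On the diagonal x = y, a null set, the integrand
   is 0 by the convention 0^-1 = 0. *)
Definition gagliardo (R : realType) (p : R) (u : R -> R) : \bar R :=
  ((\int[lebesgue_measure]_y \int[lebesgue_measure]_x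
      (`|u x - u y| `^ p / `|x - y| ^+ 2)%:E) `^ p^-1)%E.

Definition sobolev_norm (R : realType) (p : R) (u : R -> R) : \bar R :=
  (('N[lebesgue_measure]_p%:E[EFin \o u] `^ p + gagliardo p u `^ p) `^ p^-1)%E.

Definition sobolev (R : realType) (p : R) : set (R -> R) :=
  [set u | u \in Lfun lebesgue_measure p%:E /\ (gagliardo p u < +oo)%E].

Definition test_function (R : realType) (I : set R) : set (R -> R) :=
  [set phi | (forall (n : nat) (x : R), derivable (derive1n n phi) x 1) /\
             compact (closure [set x | phi x != 0]) /\
             closure [set x | phi x != 0] `<=` I].

Definition sobolev0 (R : realType) (p : R) (I : set R) : set (R -> R) :=
  [set u | sobolev p u /\
     forall e : R, 0 < e -> exists2 phi, test_function I phi &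
       (sobolev_norm p (u \- phi)%R < e%:E)%E].

Definition moser_trudinger_sup (R : realType) (s p alpha : R) (I : set R)
    : \bar R :=
  ereal_sup [set (\int[lebesgue_measure]_(x in I)
                    (expR (alpha * `|u x| `^ (1 / (1 - s))))%:E)%E
            | u in [set u | sobolev0 p I u /\ (gagliardo p u <= 1)%E]].

(* Euler's integral, meaningful for x > 0, where it converges. *)
Definition Gamma (R : realType) (x : R) : R :=
  \int[lebesgue_measure]_(t in `]0, +oo[) (t `^ (x - 1) * expR (- t)).

Definition gamma_s (R : realType) (p : R) : R :=
  8 * Gamma (p + 1) *
  limn (series (fun k : nat => 1 / ((1 + 2 * k)%:R `^ p) : R)).

Definition alpha_upper (R : realType) (s p : R) : R :=
  gamma_s p `^ (s / (1 - s)).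

(* Main.v *)
Require Import Defs.
From HB Require Import structures.
From mathcomp Require Import all_boot all_order all_algebra.
From mathcomp Require Import all_classical all_reals all_analysis.
From mathcomp Require Import measurable_realfun ring lra.
Import Order.TTheory GRing.Theory Num.Theory.
Import numFieldNormedType.Exports.
Local Open Scope classical_set_scope.
Local Open Scope ring_scope.

Set Implicit Arguments.
Unset Strict Implicit.
Unset Printing Implicit Defensive.

(** Write E(u) for the double integral of |u(x) - u(y)|^p / |x - y|^2, so that
    the seminorm is E(u)^(1/p), and recall that s = 1/p, hence that the
    exponent 1/(1-s) is the conjugate exponent of p.

    Small alpha.  Let u vanish outside an interval of length l, let E(u) <= 1,
    and let t_k be the level at which the measure of {|u| > t} drops to
    2^-k l ([exists_quantile]).  Pair a point y with |u(y)| >= t_(k+1), a set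
    of measure at least 2^-(k+1) l, with the points x where |u(x)| <= t_k,
    whose complement has measure at most 2^-k l.  The kernel |x - y|^-2
    integrates over such x to at least a constant times 2^k / l
    ([inverse_square_lower_bound]), so that each pair of consecutive levels
    contributes at least (t_(k+1) - t_k)^p / 8.  The contributions may be added
    although the regions overlap, since z -> z^p is superadditive
    ([sum_increments_powR]).  Therefore the increments of the quantiles have
    a p-th power sum of at most 8 ([sum_increments_le_energy]), and Hoelder's
    inequality gives t_N <= 9 N^(1-1/p).  In other words |u|^(1/(1-s)) exceeds
    a multiple of N only on a set of measure at most 2^-N l
    ([superlevel_exponential_decay]), and exp(alpha |u|^(1/(1-s))) is
    integrable for small alpha, uniformly in u ([exp_integral_le]).  Functions
    of the closure vanish almost everywhere outside the interval
    ([sobolev0_eq0_ae]), which is what the argument asks of them.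

    Large alpha.  The extremal profile is a logarithm truncated at height
    T = - ln d.  A smooth version is psi(- ln(x^2 + d^2) / 2), where
    psi(v) = v exp(-1/v) for v > 0 and psi(v) = 0 otherwise; psi is smooth,
    1-Lipschitz and at least v - 1.  This function ([moser]) is a genuine test
    function, so that it lies in the closure without any approximation.
    Because it is 1-Lipschitz as a function of ln |x|, the substitution
    x = rho y bounds the inner integral at y by kappa / |y|, where kappa is
    the integral of |ln |rho||^p / (rho - 1)^2 ([inner_energy_scale]).
    Integrating this over d < |y| < 2 gives 2 kappa T, while the regions
    |y| <= d and |y| >= 2 contribute a bounded amount
    ([inner_energy_center], [inner_energy_far]).  Hence the energy is at most
    2 kappa T + O(1) ([moser_energy_le]).

    The constant.  The substitutions rho = exp(z) and rho = exp(-z) turn kappa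
    into twice the integral over z > 0 of z^p times
    q / (1 - q)^2 + q / (1 + q)^2 with q = exp(-z), a function whose power
    series is the sum of 2 (2k+1) q^(2k+1).  Termwise integration yields
    kappa = 4 Gamma(p+1) sum_k (2k+1)^-p, that is 2 kappa = gamma_s
    ([kappa_gamma_s]).

    Conclusion for large alpha.  Normalised to energy 1 and moved to the given
    interval, the truncated logarithm satisfies
    |u|^(1/(1-s)) ~ T / gamma_s^(s/(1-s)) on an interval of length
    proportional to exp(-T).  If alpha > gamma_s^(s/(1-s)), the integral of
    exp(alpha |u|^(1/(1-s))) over it grows exponentially in T
    ([supercritical_infinite]). *)

(** * The Gagliardo energy *)

Section Kernel.
Context {R : realType}.
Implicit Types (u : R -> R) (p x y : R).

(** A non-negative denominator is inverted by the power function of exponent -1,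
    whose measurability is known. *)
Lemma measurable_ratio_ge0 d (T : measurableType d) (D : set T) (f g : T -> R) :
  (forall t, 0 <= g t) -> measurable_fun D f -> measurable_fun D g ->
  measurable_fun D (fun t => f t / g t).
Proof.
move=> g0 mf mg; apply: measurable_funM => //.
have -> : (fun t => (g t)^-1) = (@powR R ^~ (-1)) \o g.
  by apply/funext => t /=; rewrite powR_inv1.
exact: measurableT_comp.
Qed.

Definition slobodeckij_integrand p u x y : R :=
  `|u x - u y| `^ p / `|x - y| ^+ 2.

Lemma slobodeckij_integrand_ge0 p u x y : 0 <= slobodeckij_integrand p u x y.
Proof. by rewrite divr_ge0// powR_ge0. Qed.

Definition energy p u : \bar R :=
  (\int[lebesgue_measure]_y \int[lebesgue_measure]_x
     (slobodeckij_integrand p u x y)%:E)%E.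

Lemma energy_ge0 p u : (0 <= energy p u)%E.
Proof.
apply: integral_ge0 => y _; apply: integral_ge0 => x _.
by rewrite lee_fin slobodeckij_integrand_ge0.
Qed.

Lemma measurable_slobodeckij_integrand p u : measurable_fun setT u ->
  measurable_fun setT
    (fun z : measurableTypeR R * measurableTypeR R =>
       (slobodeckij_integrand p u z.1 z.2)%:E).
Proof.
move=> mu_; apply/measurable_EFinP.
apply: measurable_ratio_ge0 => [z||].
- exact: exprn_ge0.
- apply: (measurableT_comp (measurable_powR p)).
  apply: measurableT_comp => //; apply: measurable_funB.
    exact: measurableT_comp.
  exact: measurableT_comp.
- apply: measurable_funX; apply: measurableT_comp => //.
  exact: measurable_funB.
Qed.

Lemma measurable_slobodeckij_integrandl p u y : measurable_fun setT u ->
  measurable_fun setT (fun x => (slobodeckij_integrand p u x y)%:E).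
Proof.
move=> mu_; have := measurable_slobodeckij_integrand p mu_.
by move/(measurableT_comp)/(_ (measurable_pair2 y)).
Qed.

Lemma measurable_inner_energy p u : measurable_fun setT u ->
  measurable_fun setT (fun y => \int[lebesgue_measure]_x
     (slobodeckij_integrand p u x y)%:E)%E.
Proof.
move=> mu_.
apply: (@measurable_fun_fubini_tonelli_G _ _ _ _ _ lebesgue_measure
  (fun z => (slobodeckij_integrand p u z.1 z.2)%:E)).
  exact: measurable_slobodeckij_integrand.
by move=> z; rewrite lee_fin slobodeckij_integrand_ge0.
Qed.

(** On the unit ball the p-th root in the seminorm can be dropped. *)
Lemma gagliardo_le1 p u : 0 < p ->
  ((gagliardo p u <= 1) = (energy p u <= 1))%E.
Proof.
move=> p0; apply/idP/idP => h.
  have -> : energy p u = (gagliardo p u `^ p)%E.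
    by rewrite /gagliardo -poweRrM mulVf ?gt_eqF// poweRe1// energy_ge0.
  rewrite -(poweR1r p); apply: gt0_ler_poweR => //.
  - exact: ltW.
  - by rewrite in_itv/= leey poweR_ge0.
  - by rewrite in_itv/= leey lee01.
rewrite -(poweR1r p^-1); apply: gt0_ler_poweR => //.
- by rewrite invr_ge0 ltW.
- by rewrite in_itv/= leey energy_ge0.
- by rewrite in_itv/= leey lee01.
Qed.

End Kernel.

(** * Quantiles and level sets *)

Section Quantiles.
Context {R : realType}.
Local Notation mu := (@lebesgue_measure R).

Definition superlevel (f : R -> R) (t : R) : set R := [set x | t < f x].

Definition weak_superlevel (f : R -> R) (t : R) : set R := [set x | t <= f x].

Lemma measurable_superlevel (f : R -> R) (t : R) : measurable_fun setT f ->
  measurable (superlevel f t).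
Proof.
move=> mf; have -> : superlevel f t = f @^-1` `]t, +oo[.
  by apply/seteqP; split=> x /=; rewrite in_itv/= andbT.
by rewrite -[X in measurable X]setTI; exact: mf.
Qed.

Lemma measurable_weak_superlevel (f : R -> R) (t : R) : measurable_fun setT f ->
  measurable (weak_superlevel f t).
Proof.
move=> mf; have -> : weak_superlevel f t = f @^-1` `[t, +oo[.
  by apply/seteqP; split=> x /=; rewrite in_itv/= andbT.
by rewrite -[X in measurable X]setTI; exact: mf.
Qed.

(** The infimum t of the levels that f exceeds on a set of measure at most c.
    Continuity of the measure along t + 1/n shows that the strict superlevel
    set still has measure at most c, and along t (1 - 1/n) that the weak one
    has measure at least c. *)
Lemma exists_quantile (f : R -> R) (l c : R) : measurable_fun setT f ->
  (forall x, 0 <= f x) -> (mu (superlevel f 0) <= l%:E)%E -> 0 < c ->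
  exists t, [/\ 0 <= t, (mu (superlevel f t) <= c%:E)%E,
    (c%:E <= mu (weak_superlevel f t))%E &
    forall t', 0 <= t' -> (mu (superlevel f (t')) <= c%:E)%E -> t <= t'].
Proof.
move=> mf f0 fl c0.
have anti s t : s <= t -> (mu (superlevel f t) <= mu (superlevel f s))%E.
  move=> st; apply: le_measure; rewrite ?inE; try exact: measurable_superlevel.
  by move=> x /=; exact: le_lt_trans.
pose S := [set t | 0 <= t /\ (mu (superlevel f t) <= c%:E)%E].
have S0 : S !=set0.
  have h : mu \o (fun n => superlevel f (n%:R)) @ \oo -->
      mu (\bigcap_n superlevel f (n%:R)).
    apply: nonincreasing_cvg_mu => //=.
    - by rewrite (le_lt_trans fl)// ltry.
    - by move=> i; exact: measurable_superlevel.
    - by apply: bigcap_measurable => // i _; exact: measurable_superlevel.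
    - move=> m n mn; apply/subsetPset => x /=; apply: le_lt_trans.
      by rewrite ler_nat.
  have e0 : \bigcap_n superlevel f (n%:R) = set0.
    apply/seteqP; split => // x /= h1.
    have := h1 (Num.bound (f x)) I; rewrite /superlevel/=.
    by rewrite ltNge ltW// archi_boundP.
  move: h; rewrite e0 measure0 => h.
  have : \forall n \near \oo, (mu (superlevel f (n%:R)) < c%:E)%E.
    by apply: (h [set y | (y < c%:E)%E]); exact: (nbhs_open_ereal_lt (f := cst c)).
  move=> [n _ /(_ n (leqnn n)) hn]; exists n%:R; split=> //.
  exact: ltW.
have lbS : has_lbound S by exists 0 => t [].
have infS0 : 0 <= inf S by apply: lb_le_inf => // t [].
exists (inf S); split => //.
- have h : mu \o (fun n => superlevel f (inf S + n.+1%:R^-1)) @ \oo -->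
      mu (\bigcup_n superlevel f (inf S + n.+1%:R^-1)).
    apply: nondecreasing_cvg_mu => //=.
    - by move=> i; exact: measurable_superlevel.
    - by apply: bigcup_measurable => // i _; exact: measurable_superlevel.
    - move=> m n mn; apply/subsetPset => x /=; apply: le_lt_trans.
      by rewrite lerD2l lef_pV2 ?posrE// ler_nat.
  have e0 : \bigcup_n superlevel f (inf S + n.+1%:R^-1) = superlevel f (inf S).
    apply/seteqP; split => x /=.
      by move=> [n _ /=]; apply: lt_trans; rewrite ltrDl.
    move/ltr_add_invr => [k hk]; exists k => //=.
  move: h; rewrite e0 => h.
  rewrite -(cvg_lim _ h)//; apply: lime_le; first by apply/cvg_ex; eexists; exact: h.
  apply: nearW => n /=.
  have [t [t0 tc] tlt] : exists2 t, S t & t < inf S + n.+1%:R^-1.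
    by apply: inf_adherent => //; rewrite invr_gt0.
  by apply: le_trans tc; apply: anti; exact: ltW.
- have [s0|s0] := leP (inf S) 0.
    have -> : weak_superlevel f (inf S) = setT.
      by apply/seteqP; split => // x _ /=; exact: le_trans (f0 x).
    have /= := @lebesgue_measure_itv R `]-oo, +oo[.
    rewrite set_itvNyy => ->; exact: leey.
  have kk (n : nat) : inf S * (1 - n.+2%:R^-1) < inf S.
    by rewrite gtr_pMr// ltrBlDr ltrDl invr_gt0.
  have h : mu \o (fun n => superlevel f (inf S * (1 - n.+2%:R^-1))) @ \oo -->
      mu (\bigcap_n superlevel f (inf S * (1 - n.+2%:R^-1))).
    apply: nonincreasing_cvg_mu => //=.
    - apply: (@le_lt_trans _ _ (mu (superlevel f 0))).
        apply: anti; rewrite mulr_ge0// subr_ge0 invf_le1//.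
        by rewrite ler1n.
      by rewrite (le_lt_trans fl)// ltry.
    - by move=> i; exact: measurable_superlevel.
    - by apply: bigcap_measurable => // i _; exact: measurable_superlevel.
    - move=> m n mn; apply/subsetPset => x /=; apply: le_lt_trans.
      by rewrite ler_pM2l// lerB// lef_pV2 ?posrE// ler_nat !ltnS.
  have e0 : \bigcap_n superlevel f (inf S * (1 - n.+2%:R^-1)) =
      weak_superlevel f (inf S).
    apply/seteqP; split => x /=; last first.
      by move=> h1 n _ /=; apply: lt_le_trans h1.
    move=> h1; rewrite /weak_superlevel/= leNgt; apply/negP => h2.
    have e1 : 0 < 1 - f x / inf S.
      by rewrite subr_gt0 ltr_pdivrMr// mul1r.
    have [k hk] := ltr_add_invr e1.
    have := h1 k I; rewrite /superlevel/=; apply/negP; rewrite -leNgt.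
    have fE : f x = inf S * (f x / inf S) by rewrite mulrC divfK// gt_eqF.
    rewrite [leLHS]fE ler_pM2l//.
    have hk2 : k.+2%:R^-1 <= k.+1%:R^-1 :> R by rewrite lef_pV2 ?posrE// ler_nat.
    move: hk hk2; set a := k.+1%:R^-1; set b := k.+2%:R^-1; set c' := f x / inf S.
    by move=> hk hk2; lra.
  move: h; rewrite e0 => h.
  rewrite -(cvg_lim _ h)//; apply: lime_ge; first by apply/cvg_ex; eexists; exact: h.
  apply: nearW => n /=; rewrite leNgt; apply/negP => /ltW h1.
  have : S (inf S * (1 - n.+2%:R^-1)).
    split => //; rewrite mulr_ge0// subr_ge0 invf_le1//.
    by rewrite ler1n.
  by move/(ge_inf lbS); apply/negP; rewrite -ltNge.
- by move=> t' t'0 h; apply: ge_inf.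
Qed.

(** If the complement of G has measure at most M, then at least half of the
    interval from y to y + 2M belongs to G, and the kernel is at least
    (2M)^-2 there.  The interval is one-sided so as to avoid the point y,
    where the kernel is 0 by convention. *)
Lemma inverse_square_lower_bound (G : set R) (M y : R) : measurable G ->
  0 < M -> (mu (~` G) <= M%:E)%E ->
  ((4 * M)^-1%:E <= \int[mu]_(x in G) ((`|x - y| ^+ 2)^-1)%:E)%E.
Proof.
move=> mG M0 GM; pose D : set R := `]y, y + 2 * M]%classic.
have mD : measurable D by exact: measurable_itv.
have muD : mu D = (2 * M)%:E.
  rewrite lebesgue_measure_itv/= lte_fin ltrDl mulr_gt0// -EFinD.
  by congr EFin; ring.
have mDG : measurable (D `&` G) by exact: measurableI.
have hM : (M%:E <= mu (D `&` G))%E.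
  have : (mu D <= mu (D `&` G) + mu (~` G))%E.
    apply: (@le_trans _ _ (mu ((D `&` G) `|` ~` G))).
      apply: le_measure; rewrite ?inE//.
        by apply: measurableU => //; exact: measurableC.
      by move=> x Dx; have [Gx|Gx] := pselect (G x); [left|right].
    by apply: measureU2 => //; exact: measurableC.
  rewrite muD => h.
  have h2 : ((2 * M)%:E <= mu (D `&` G) + M%:E)%E.
    by apply: (le_trans h); exact: leeD2l.
  move: h2; rewrite -leeBlDr// -EFinB; apply: le_trans.
  by rewrite lee_fin; lra.
have mk : measurable_fun setT (fun x : R => ((`|x - y| ^+ 2)^-1)%:E).
  apply/measurable_EFinP.
  rewrite (_ : (fun x => _) = fun x : R => 1 / (`|x - y| ^+ 2)); last first.
    by apply/funext => x; rewrite div1r.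
  apply: measurable_ratio_ge0 => //.
    by apply: measurable_funX; apply: measurableT_comp => //; exact: measurable_funB.
apply: (@le_trans _ _ (\int[mu]_(x in D `&` G) ((4 * M ^+ 2)^-1)%:E)%E).
  rewrite integral_cst//.
  apply: (@le_trans _ _ (((4 * M ^+ 2)^-1)%:E * M%:E)%E).
    rewrite -EFinM lee_fin le_eqVlt; apply/orP; left; apply/eqP.
    by field; rewrite gt_eqF.
  by apply: lee_wpmul2l => //; rewrite lee_fin invr_ge0 mulr_ge0// sqr_ge0.
apply: (@le_trans _ _ (\int[mu]_(x in D `&` G) ((`|x - y| ^+ 2)^-1)%:E)%E).
  apply: ge0_le_integral => //.
  - by move=> x _; rewrite lee_fin invr_ge0 mulr_ge0// sqr_ge0.
  - exact: measurable_funTS.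
  - move=> x [+ _]; rewrite /D/= in_itv/= => /andP[yx xM].
    rewrite lee_fin lef_pV2 ?posrE.
    + rewrite ger0_norm ?subr_ge0 ?(ltW yx)//.
      have -> : 4 * M ^+ 2 = (2 * M) ^+ 2 by ring.
      by rewrite ler_pXn2r ?nnegrE ?subr_ge0 ?(ltW yx) ?mulr_ge0 ?(ltW M0)// lerBlDl.
    + by rewrite mulr_gt0// exprn_gt0.
    + by rewrite exprn_gt0// normr_gt0 subr_eq0 gt_eqF.
apply: ge0_subset_integral => //.
exact: measurable_funTS.
Qed.

(** Write a^p as a times a^(p-1) and increase the second factor. *)
Lemma powR_superadditive (p a b : R) : 1 <= p -> 0 <= a -> 0 <= b ->
  a `^ p + b `^ p <= (a + b) `^ p.
Proof.
move=> p1 a0 b0.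
have p0 : 0 < p by exact: lt_le_trans p1.
rewrite -(mulr_powRB1 a0 p0) -(mulr_powRB1 b0 p0) -(mulr_powRB1 (addr_ge0 a0 b0) p0).
rewrite mulrDl; apply: lerD; apply: ler_wpM2l => //; apply: ge0_ler_powR => //;
  rewrite ?nnegrE ?subr_ge0 ?addr_ge0//; lra.
Qed.

(** The increments that are counted belong to consecutive levels between b and
    a, so that their sum is at most a - b; superadditivity of the p-th power
    passes this on to the sum of the powers. *)
Lemma sum_increments_powR (p : R) (t : nat -> R) (a b : R) N : 1 <= p ->
  (forall k, t k <= t k.+1) ->
  \sum_(k < N) (if (t k.+1 <= a) && (b <= t k)
                then (t k.+1 - t k) `^ p else 0) <= `|a - b| `^ p.
Proof.
move=> p1 tS.
have p0 : 0 <= p by lra.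
(* The induction needs the part of a - b that lies below the last level. *)
apply: (@le_trans _ _ ((Num.max 0 (Num.min a (t N) - b)) `^ p)); last first.
  apply: ge0_ler_powR => //; rewrite ?nnegrE ?le_max ?lexx//.
  rewrite ge_max normr_ge0/=; apply: (le_trans _ (ler_norm _)).
  by rewrite lerD2r ge_min lexx.
elim: N => [|N IH]; first by rewrite big_ord0 powR_ge0.
rewrite big_ord_recr/=; case: ifPn => [/andP[h1 h2]|_].
  have h3 := tS N.
  have e1 : Num.min a (t N) = t N by apply/min_idPr; exact: le_trans h1.
  have e2 : Num.min a (t N.+1) = t N.+1 by apply/min_idPr.
  rewrite e1 (max_idPr _) ?subr_ge0// in IH.
  rewrite e2 (max_idPr _) ?subr_ge0 ?(le_trans h2)//.
  apply: (le_trans (lerD IH (lexx _))).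
  have := @powR_superadditive p (t N - b) (t N.+1 - t N) p1.
  rewrite !subr_ge0 => /(_ h2 h3).
  by have -> : t N - b + (t N.+1 - t N) = t N.+1 - b by ring.
rewrite addr0; apply: (le_trans IH).
have max0 (z : R) : 0 <= Num.max 0 z by rewrite le_max lexx.
apply: ge0_ler_powR => //; rewrite ?nnegrE ?max0//.
rewrite ge_max max0/= le_max lerD2r; apply/orP; right.
by rewrite le_min ge_min lexx/= ge_min tS orbT.
Qed.

End Quantiles.

(** * Exponential decay of the distribution function *)

Section ExponentialDecay.
Context {R : realType}.
Local Notation mu := (@lebesgue_measure R).

Lemma measurable_norm_comp (u : R -> R) : measurable_fun setT u ->
  measurable_fun setT (fun x => `|u x|).
Proof. by move=> mu_; exact: measurableT_comp. Qed.

Lemma measurable_indic_setT (A : set R) : measurable A ->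
  measurable_fun setT (fun x : R => \1_A x : R).
Proof. by move=> mA; exact: measurable_indic. Qed.

Lemma integral_indic_on (A D : set R) : measurable D -> measurable A ->
  (\int[mu]_(x in D) (\1_A x)%:E = mu (A `&` D))%E.
Proof. by move=> mD mA; rewrite integral_indic. Qed.

Lemma integral_indic_setT (A : set R) : measurable A ->
  (\int[mu]_x (\1_A x)%:E = mu A)%E.
Proof. by move=> mA; rewrite integral_indic ?setIT. Qed.

(** The integrand of the energy dominates the sum over k of
    (t_(k+1) - t_k)^p / |x - y|^2 restricted to |u(y)| >= t_(k+1) and
    |u(x)| <= t_k.  Integrating in x loses the factor 4 m_k and integrating in
    y gains m_(k+1) >= m_k / 2, hence the constant 8. *)
Lemma sum_increments_le_energy (p : R) (u : R -> R) (t m : nat -> R) N :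
  1 <= p -> measurable_fun setT u ->
  (forall k, 0 < m k) -> (forall k, m k <= 2 * m k.+1) ->
  (forall k, t k <= t k.+1) ->
  (forall k, (mu (superlevel (Num.norm \o u) (t k)) <= (m k)%:E)%E) ->
  (forall k, ((m k)%:E <= mu (weak_superlevel (Num.norm \o u) (t k)))%E) ->
  ((\sum_(k < N) (t k.+1 - t k) `^ p)%:E <= 8%:E * energy p u)%E.
Proof.
move=> p1 mfu m0 m2 tS tlo thi.
have mu_ := measurable_norm_comp mfu.
pose E k := weak_superlevel (Num.norm \o u) (t k.+1).
pose G k := ~` superlevel (Num.norm \o u) (t k).
have mE k : measurable (E k) by exact: measurable_weak_superlevel.
have mG k : measurable (G k) by apply: measurableC; exact: measurable_superlevel.
pose c k : R := (t k.+1 - t k) `^ p.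
have c0 k : 0 <= c k by exact: powR_ge0.
have mker y : measurable_fun setT (fun x : R => ((`|x - y| ^+ 2)^-1)).
  rewrite (_ : (fun x => _) = fun x : R => 1 / (`|x - y| ^+ 2)); last first.
    by apply/funext => x; rewrite div1r.
  apply: measurable_ratio_ge0 => //.
    by apply: measurable_funX; apply: measurableT_comp => //; exact: measurable_funB.
have m1 := measurable_indic_setT.
have mGk k y : measurable_fun setT (fun x : R => \1_(G k) x * (`|x - y| ^+ 2)^-1).
  by apply: measurable_funM => //; exact: m1.
have mGt k y : measurable_fun setT (fun x : R =>
    (c k * \1_(E k) y * (\1_(G k) x * (`|x - y| ^+ 2)^-1))%:E).
  by apply/measurable_EFinP; exact: measurable_funM.
have mEt k : measurable_fun setT (fun y : R =>
    (c k * \1_(E k) y / (4 * m k))%:E).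
  by apply/measurable_EFinP; do 2 apply: measurable_funM => //; exact: m1.
have inner y : (\sum_(k < N) (c k * \1_(E k) y / (4 * m k))%:E <=
    \int[mu]_x (slobodeckij_integrand p u x y)%:E)%E.
  apply: (@le_trans _ _ (\int[mu]_x (\sum_(k < N)
      (c k * \1_(E k) y * (\1_(G k) x * (`|x - y| ^+ 2)^-1))%:E))%E).
    rewrite ge0_integral_sum//; last 2 first.
    - by move=> k; exact: mGt.
    - by move=> k x _; rewrite lee_fin !mulr_ge0// invr_ge0 exprn_ge0.
    apply: lee_sum => k _.
    under eq_integral do rewrite EFinM.
    rewrite ge0_integralZl_EFin//; last 2 first.
    - by apply/measurable_EFinP; exact: mGk.
    - by rewrite mulr_ge0.
    rewrite EFinM; apply: lee_wpmul2l; first by rewrite lee_fin mulr_ge0.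
    have hG : (mu (~` G k) <= (m k)%:E)%E by rewrite /G setCK.
    have -> : (fun x : R => (\1_(G k) x * (`|x - y| ^+ 2)^-1)%:E) =
        (fun x : R => ((`|x - y| ^+ 2)^-1)%:E) \_ (G k).
      apply/funext => x; rewrite patchE indicE.
      by case: ifP => _; rewrite ?mul1r ?mul0r.
    rewrite -integral_mkcond.
    exact: inverse_square_lower_bound.
  apply: ge0_le_integral => //.
  - by move=> x _; apply: sume_ge0 => k _; rewrite lee_fin !mulr_ge0// invr_ge0 exprn_ge0.
  - by apply: emeasurable_sum => k; exact: mGt.
  - exact: measurable_slobodeckij_integrandl.
  move=> x _; rewrite sumEFin lee_fin.
  under eq_bigr => k _ do rewrite mulrA.
  rewrite -mulr_suml ler_wpM2r ?invr_ge0 ?exprn_ge0//.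
  rewrite (_ : `|u x - u y| = `|u y - u x|); last by rewrite distrC.
  apply: (@le_trans _ _ (`| `|u y| - `|u x| | `^ p)); last first.
    apply: ge0_ler_powR; rewrite ?nnegrE//; first by lra.
    exact: ler_dist_dist.
  apply: le_trans (sum_increments_powR `|u y| `|u x| N p1 tS).
  apply: ler_sum => k _.
  rewrite !indicE; case: ifPn => [_|].
    rewrite -[leRHS]mulr1 -mulrA ler_wpM2l//.
    by case: (_ \in _); case: (_ \in _); rewrite ?mulr0 ?mulr1.
  rewrite negb_and -!ltNge => /orP[h|h].
    by rewrite [y \in _]memNset ?mulr0 ?mul0r// /E /weak_superlevel/=;
      apply/negP; rewrite -ltNge.
  by rewrite [x \in _]memNset ?mulr0// /G/= => -[]; exact.
have : (\sum_(k < N) (c k / 8)%:E <= energy p u)%E.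
  apply: (@le_trans _ _ (\int[mu]_y \sum_(k < N) (c k * \1_(E k) y / (4 * m k))%:E)%E).
    rewrite ge0_integral_sum//; last 2 first.
    - by move=> k; exact: mEt.
    - by move=> k x _; rewrite lee_fin !mulr_ge0// invr_ge0 mulr_ge0// ltW.
    apply: lee_sum => k _.
    under eq_integral => y _ do rewrite mulrAC EFinM.
    rewrite ge0_integralZl_EFin//; last 2 first.
    - by apply/measurable_EFinP; exact: m1.
    - by rewrite mulr_ge0// invr_ge0 mulr_ge0// ltW.
    rewrite [X in (_ * X)%E](_ : _ = mu (E k)); last first.
      exact: integral_indic_setT.
    apply: (@le_trans _ _ ((c k / (4 * m k))%:E * (m k.+1)%:E)%E).
      rewrite -EFinM lee_fin -mulrA ler_wpM2l//.
      rewrite -[leRHS]mulrC ler_pdivlMr ?mulr_gt0//.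
      have := m2 k; lra.
    by apply: lee_wpmul2l => //; rewrite lee_fin mulr_ge0// invr_ge0 mulr_ge0// ltW.
  apply: ge0_le_integral => //.
  - by move=> x _; apply: sume_ge0 => k _; rewrite lee_fin !mulr_ge0// invr_ge0 mulr_ge0// ltW.
  - by apply: emeasurable_sum => k; exact: mEt.
  - exact: measurable_inner_energy.
move=> h.
rewrite (_ : (\sum_(k < N) (t k.+1 - t k) `^ p)%:E =
   (8%:E * \sum_(k < N) (c k / 8)%:E)%E); last first.
  rewrite sumEFin -EFinM -mulr_suml; congr EFin; rewrite mulrC divfK//.
by apply: lee_wpmul2l => //; rewrite lee_fin.
Qed.

(** A form of Hoelder's inequality.  Each a_k is at most c + a_k^p c^(1-p),
    whichever of a_k and c is larger; the choice c = N^(-1/p) balances both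
    terms. *)
Lemma sum_le_of_sum_powR (p : R) (a : nat -> R) N : 1 <= p ->
  (forall k, 0 <= a k) -> \sum_(k < N) a k `^ p <= 8 ->
  \sum_(k < N) a k <= 9 * N%:R `^ (1 - p^-1).
Proof.
move=> p1 a0 hs; case: N hs => [_|N hs].
  by rewrite big_ord0 mulr_ge0// powR_ge0.
set n : R := N.+1%:R; have n0 : 0 < n by rewrite ltr0n.
have p0 : 0 < p by lra.
(* This value of c equates n c with c^(1-p). *)
pose c : R := n `^ (- p^-1).
have c0 : 0 < c by exact: powR_gt0.
have step k : a k <= c + a k `^ p * c `^ (1 - p).
  have [ac|ca] := leP (a k) c.
    by rewrite (le_trans ac)// lerDl mulr_ge0// powR_ge0.
  apply: (@le_trans _ _ (a k `^ p * c `^ (1 - p))); last by rewrite lerDr ltW.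
  have ak0 : 0 < a k by exact: lt_trans ca.
  rewrite [leLHS](_ : a k = a k `^ p * a k `^ (1 - p)); last first.
    by rewrite -powRD ?(gt_eqF ak0) ?implybT// subrKC powRr1.
  have e q : q `^ (1 - p) = (q `^ (p - 1))^-1 :> R by rewrite -powRN opprB.
  rewrite ler_wpM2l ?powR_ge0// !e lef_pV2 ?posrE ?powR_gt0//.
  by apply: ge0_ler_powR; rewrite ?nnegrE ?subr_ge0//; exact: ltW.
apply: (@le_trans _ _ (\sum_(k < N.+1) (c + a k `^ p * c `^ (1 - p)))).
  by apply: ler_sum => k _; exact: step.
rewrite big_split/= sumr_const card_ord -mulr_suml -[c *+ _]mulr_natr -/n.
have e1 : c * n = n `^ (1 - p^-1).
  by rewrite mulrC -{1}(powRr1 (ltW n0)) -powRD ?(gt_eqF n0) ?implybT.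
have e2 : c `^ (1 - p) = n `^ (1 - p^-1).
  rewrite /c -powRrM; congr (_ `^ _).
  by field; rewrite gt_eqF.
rewrite e1 e2.
have : \sum_(k < N.+1) a k `^ p * n `^ (1 - p^-1) <= 8 * n `^ (1 - p^-1).
  by rewrite -mulr_suml ler_wpM2r// powR_ge0.
rewrite -mulr_suml; lra.
Qed.

(** The quantiles t_k at the measures 2^-k l start from t_0 = 0, so that t_N is
    the sum of its increments, which are controlled by the energy. *)
Lemma superlevel_exponential_decay (p l : R) (u : R -> R) N : 1 <= p -> 0 < l ->
  measurable_fun setT u -> (energy p u <= 1)%E ->
  (mu (superlevel (Num.norm \o u) 0) <= l%:E)%E ->
  (mu (superlevel (Num.norm \o u) (9 * N%:R `^ (1 - p^-1)))
     <= (l * 2^-1 ^+ N)%:E)%E.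
Proof.
move=> p1 l0 mfu Eu ul.
have mu_ : measurable_fun setT (Num.norm \o u) by exact: measurable_norm_comp.
pose m k : R := l * 2^-1 ^+ k.
have m0 k : 0 < m k by rewrite mulr_gt0// exprn_gt0.
have mS k : m k.+1 = m k / 2 by rewrite /m exprSr mulrA.
have := fun k => @exists_quantile _ _ l (m k) mu_ (fun x => normr_ge0 _) ul (m0 k).
move=> /choice[t ht].
have t0 : t 0%N = 0.
  have [h1 _ _ h2] := ht 0%N; apply/eqP; rewrite eq_le h1 andbT.
  by apply: h2 => //; rewrite /m expr0 mulr1.
have tS k : t k <= t k.+1.
  have [_ _ _ h2] := ht k; have [h3 h4 _ _] := ht k.+1.
  apply: h2 => //; apply: (le_trans h4).
  by rewrite lee_fin mS; have := m0 k; lra.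
have hE : ((\sum_(k < N) (t k.+1 - t k) `^ p)%:E <= 8%:E * energy p u)%E.
  apply: (@sum_increments_le_energy p u t m) => //.
  - by move=> k; rewrite mS; have := m0 k; lra.
  - by move=> k; have [] := ht k.
  - by move=> k; have [] := ht k.
have h8 : \sum_(k < N) (t k.+1 - t k) `^ p <= 8.
  rewrite -lee_fin; apply: (le_trans hE).
  by rewrite -[leRHS]mule1; apply: lee_wpmul2l.
have := @sum_le_of_sum_powR p (fun k => t k.+1 - t k) N p1 _ h8.
rewrite -(big_mkord xpredT (fun k => t k.+1 - t k)) telescope_sumr// t0 subr0.
move=> /(_ (fun k => _)) tN.
have [_ h _ _] := ht N; apply: le_trans h.
apply: le_measure; rewrite ?inE; try exact: measurable_superlevel.
move=> x; rewrite /superlevel/=; apply: le_lt_trans; apply: tN => k.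
by rewrite subr_ge0.
Qed.

End ExponentialDecay.

(** * The subcritical bound *)

Section SubcriticalBound.
Context {R : realType}.
Local Notation mu := (@lebesgue_measure R).

Lemma test_function_continuous (I : set R) phi : test_function I phi ->
  continuous phi.
Proof.
move=> [h _] x; apply: differentiable_continuous; apply/derivable1_diffP.
exact: (h 0%N x).
Qed.

Lemma test_function_eq0 (I : set R) phi x : test_function I phi -> ~ I x ->
  phi x = 0.
Proof.
move=> [_ [_ h]] Ix; apply/eqP; apply: contra_notT Ix => phix.
by apply: h; apply: subset_closure.
Qed.

(** Outside I every test function vanishes, so the L^p norm of u there is at
    most the distance from u to the test functions, which is 0. *)
Lemma sobolev0_eq0_ae (p : R) (I : set R) u : 0 < p -> measurable I ->
  sobolev0 p I u -> mu (superlevel (Num.norm \o u) 0 `\` I) = 0%E.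
Proof.
move=> p0 mI [[uL _] uapx].
have mfu : measurable_fun setT u by move/sub_Lfun_mfun: uL; rewrite inE.
have mS : measurable (superlevel (Num.norm \o u) 0 `\` I).
  by apply: measurableD => //; apply: measurable_superlevel; exact: measurable_norm_comp.
set S := _ `\` I in mS *.
pose f x : \bar R := (`|u x| `^ p)%:E.
have mf : measurable_fun setT f.
  apply/measurable_EFinP; apply: (measurableT_comp (measurable_powR p)).
  exact: measurable_norm_comp.
have bnd e : 0 < e -> (\int[mu]_(x in S) f x <= (e `^ p)%:E)%E.
  move=> e0; have [phi tphi hphi] := uapx e e0.
  have mg : measurable_fun setT (u \- phi).
    apply: measurable_funB => //; apply: continuous_measurable_fun.
    exact: test_function_continuous tphi.
  have mgp : measurable_fun setT (fun x => (`|(u \- phi) x| `^ p)%:E).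
    apply/measurable_EFinP; apply: (measurableT_comp (measurable_powR p)).
    exact: measurable_norm_comp.
  have -> : (\int[mu]_(x in S) f x = \int[mu]_(x in S) (`|(u \- phi)%R x| `^ p)%:E)%E.
    apply: eq_integral => x; rewrite inE => -[_ Ix].
    by rewrite /f/= (test_function_eq0 tphi Ix) subr0.
  apply: (@le_trans _ _ (\int[mu]_x (`|(u \- phi)%R x| `^ p)%:E)%E).
    exact: ge0_subset_integral.
  have -> : (\int[mu]_x (`|(u \- phi)%R x| `^ p)%:E =
      'N[mu]_p%:E[EFin \o (u \- phi)%R] `^ p)%E.
    by rewrite poweR_Lnorm ?gt_eqF//; apply: eq_integral => x _ /=.
  apply: (@le_trans _ _ (sobolev_norm p (u \- phi)%R `^ p)%E).
    rewrite /sobolev_norm -poweRrM mulVf ?gt_eqF//.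
    by rewrite poweRe1 ?adde_ge0 ?poweR_ge0// leeDl// poweR_ge0.
  rewrite -poweR_EFin; apply: gt0_ler_poweR; first exact: ltW.
  - by rewrite in_itv/= leey poweR_ge0.
  - by rewrite in_itv/= leey lee_fin ltW.
  - exact: ltW.
have f0 : (\int[mu]_(x in S) `|f x| = 0)%E.
  have -> : (\int[mu]_(x in S) `|f x| = \int[mu]_(x in S) f x)%E.
    by apply: eq_integral => x _; rewrite gee0_abs// lee_fin powR_ge0.
  apply/eqP; rewrite eq_le integral_ge0 ?andbT; last first.
    by move=> x _; rewrite lee_fin powR_ge0.
  apply/lee_addgt0Pr => e e0; rewrite add0e.
  have := bnd (e `^ p^-1) (powR_gt0 _ e0).
  by rewrite -powRrM mulVf ?gt_eqF// powRr1// ltW.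
have mfS : measurable_fun S f by exact: measurable_funTS.
have := (ae_eq_integral_abs mu mS mfS).1 f0.
move=> h; apply/negligibleP => //; apply: negligibleS h.
move=> x Sx /=; apply/not_implyP; split => //.
move: Sx => [ux _]; rewrite /f/= => -[] /eqP.
by rewrite powR_eq0 normr_eq0 -[X in X && _]negbK -normr_gt0 ux.
Qed.

Lemma sobolev0_support_measure (p a b : R) u : 0 < p -> a < b ->
  sobolev0 p `]a, b[ u -> (mu (superlevel (Num.norm \o u) 0) <= (b - a)%:E)%E.
Proof.
move=> p0 ab hu.
have mfu : measurable_fun setT u by move: hu => [[/sub_Lfun_mfun + _] _]; rewrite inE.
have mS : measurable (superlevel (Num.norm \o u) 0).
  by apply: measurable_superlevel; exact: measurable_norm_comp.
have mI : measurable `]a, b[ by exact: measurable_itv.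
have hI : mu `]a, b[%classic = (b - a)%:E.
  by rewrite lebesgue_measure_itv/= lte_fin ab -EFinD.
have -> : (b - a)%:E = (mu `]a, b[%classic + 0)%E by rewrite hI adde0.
rewrite -(sobolev0_eq0_ae p0 mI hu).
have mD : measurable (superlevel (Num.norm \o u) 0 `\` `]a, b[%classic).
  exact: measurableD.
apply: (le_trans _ (measureU2 _ _ _)) => //.
apply: le_measure; rewrite ?inE//; first exact: measurableU.
move=> x ux; have [Ix|Ix] := pselect (`]a, b[%classic x); first by left.
by right.
Qed.

(** On the n-th layer |u|^r is at most 9^r (n+1), so that the integrand is at
    most (3/2)^(n+1), whereas the layer has measure at most 2^(1-n) l: the sum
    is dominated by the geometric series of ratio 3/4. *)
Lemma exp_integral_le (r l alpha : R) (u : R -> R) (D : set R) :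
  measurable D -> measurable_fun setT u -> 1 <= r -> 0 < l ->
  (mu D <= l%:E)%E ->
  (forall N, (mu (superlevel (Num.norm \o u) (9 * N%:R `^ r^-1))
     <= (l * 2^-1 ^+ N)%:E)%E) ->
  0 <= alpha -> alpha * 9 `^ r <= ln (3 / 2) ->
  (\int[mu]_(x in D) (expR (alpha * `|u x| `^ r))%:E <= (12 * l)%:E)%E.
Proof.
move=> mD mfu r1 l0 muD dec a0 ar.
have r0 : 0 < r by lra.
have mu_ : measurable_fun setT (Num.norm \o u) by exact: measurable_norm_comp.
(* The shift of the index by one turns the weak inequality given by the integer
   part into the strict one that defines a superlevel set. *)
pose B n := if n is k.+1 then
  D `&` superlevel (Num.norm \o u) (9 * k%:R `^ r^-1) else D.
have mB n : measurable (B n).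
  by case: n => [|n] //=; apply: measurableI => //; exact: measurable_superlevel.
have BD n : B n `&` D = B n.
  by case: n => [|k] /=; rewrite ?setIid// setIAC setIid.
have muB n : (mu (B n) <= (2 * l * 2^-1 ^+ n)%:E)%E.
  case: n => [|n].
    by rewrite expr0 mulr1 (le_trans muD)// lee_fin; lra.
  apply: (le_trans (measureIr _ _ _)) => //; first exact: measurable_superlevel.
  apply: (le_trans (dec n)); rewrite lee_fin exprS.
  by set z := 2^-1 ^+ n; lra.
pose f n x : \bar R := ((3 / 2) ^+ n.+1 * \1_(B n) x)%:E.
have f0 n x : (0 <= f n x)%E by rewrite lee_fin mulr_ge0// exprn_ge0// divr_ge0.
have mf n : measurable_fun setT (f n).
  by apply/measurable_EFinP; apply: measurable_funM => //; exact: measurable_indic_setT.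
have mfD n : measurable_fun D (f n) by exact: measurable_funTS.
have m1 : measurable_fun setT (fun x => (expR (alpha * `|u x| `^ r))%:E).
  apply/measurable_EFinP; apply: measurableT_comp => //.
  apply: measurable_funM => //; apply: (measurableT_comp (measurable_powR r)).
  exact: measurable_norm_comp.
apply: (@le_trans _ _ (\int[mu]_(x in D) (\sum_(n <oo) f n x))%E).
  apply: ge0_le_integral => //.
  - exact: measurable_funTS.
  - by apply: (@ge0_emeasurable_sum _ _ _ D f xpredT) => n *; [exact: f0|exact: mfD].
  move=> x Dx; pose n := Num.trunc ((`|u x| / 9) `^ r).
  have /andP[n1 n2] := @truncn_itv _ _ (powR_ge0 (`|u x| / 9) r).
  rewrite -/n in n1 n2.
  apply: (le_trans _ (@nneseries_lim_ge _ (fun n => f n x) xpredT 0%N n.+1 _)) => //.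
  rewrite big_nat_recr//=; apply: (@le_trans _ _ (f n x)); last first.
    by rewrite leeDr// sume_ge0.
  have Bx : B n x.
    clear n2; move: n1; case: n => [//|k] /= n1; split=> //; rewrite /superlevel/=.
    have h9 : k.+1%:R `^ r^-1 <= `|u x| / 9.
      rewrite [leRHS](_ : _ = (((`|u x| / 9) `^ r) `^ r^-1)); last first.
        by rewrite -powRrM mulfV ?gt_eqF// powRr1 ?divr_ge0.
      by apply: ge0_ler_powR; rewrite ?nnegrE ?powR_ge0// invr_ge0 ltW.
    rewrite ler_pdivlMr// mulrC in h9; apply: lt_le_trans h9.
    rewrite ltr_pM2l//; apply: gt0_ltr_powR; rewrite ?nnegrE ?invr_gt0//.
    by rewrite ltr_nat.
  rewrite /f indicE mem_set// mulr1 lee_fin.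
  have -> : (3 / 2 : R) = expR (ln (3 / 2)) by rewrite lnK// posrE divr_gt0.
  rewrite -expRM_natl ler_expR.
  have -> : `|u x| `^ r = 9 `^ r * (`|u x| / 9) `^ r.
    by rewrite -powRM ?divr_ge0// mulrC divfK.
  rewrite mulrA mulrC; apply: ler_pM => //.
  - by rewrite mulr_ge0// powR_ge0.
  - exact: ltW.
rewrite integral_nneseries//.
apply: lime_le; first by apply: is_cvg_nneseries => n _ _; apply: integral_ge0.
apply: nearW => N.
apply: (@le_trans _ _ (\sum_(0 <= i < N) (3 * l * (3 / 4) ^+ i)%:E)%E).
  apply: lee_sum => n _.
  rewrite (_ : \int[mu]_(x in D) f n x = ((3 / 2) ^+ n.+1)%:E * mu (B n))%E; last first.
    under eq_integral do rewrite /f EFinM.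
    rewrite ge0_integralZl_EFin//.
    - rewrite -[in RHS]BD; congr (_ * _)%E; exact: integral_indic_on.
    - by apply/measurable_EFinP; apply: measurable_funTS; exact: measurable_indic_setT.
  apply: (@le_trans _ _ (((3 / 2) ^+ n.+1)%:E * (2 * l * 2^-1 ^+ n)%:E)%E).
    by apply: lee_wpmul2l => //; rewrite lee_fin exprn_ge0// divr_ge0.
  rewrite -EFinM lee_fin exprS.
  have -> : (3 / 4 : R) = (3 / 2) * 2^-1 by lra.
  rewrite [(3 / 2 / 2) ^+ n]exprMn; set x := (3 / 2) ^+ n; set y := _ ^+ n.
  by rewrite le_eqVlt; apply/orP; left; apply/eqP; field.
rewrite sumEFin lee_fin.
have h34 : `|3 / 4 : R| < 1 by rewrite ger0_norm; lra.
have h34' : (0 : R) < 3 / 4 by lra.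
have l3 : 0 <= 3 * l by lra.
have := @geometric_le_lim R N (3 * l) (3 / 4) l3 h34' h34.
move=> /le_trans; apply.
have -> : 1 - 3 / 4 = 4^-1 :> R by lra.
by rewrite invrK; lra.
Qed.

Theorem subcritical_finite (s p : R) : 0 < s -> s < 1 -> 1 < p -> s * p = 1 ->
  exists alpha_lower : R, 0 < alpha_lower /\
     forall a b : R, a < b ->
     forall alpha : R, 0 <= alpha -> alpha < alpha_lower ->
       (moser_trudinger_sup s p alpha `]a, b[ < +oo)%E.
Proof.
move=> s0 s1 p1 sp.
have p0 : 0 < p by lra.
have ps : p^-1 = s.
  by apply: (mulIf (lt0r_neq0 p0)); rewrite mulVf ?gt_eqF// sp.
set r := 1 / (1 - s).
have r1 : 1 <= r by rewrite /r ler_pdivlMr; lra.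
have rV : r^-1 = 1 - p^-1 by rewrite /r div1r invrK ps.
have q0 : 0 < 9 `^ r by exact: powR_gt0.
exists (ln (3 / 2) / 9 `^ r); split.
  by rewrite divr_gt0// ln_gt0//; lra.
move=> a b ab alpha al0 al; have l0 : 0 < b - a by rewrite subr_gt0.
apply: (@le_lt_trans _ _ (12 * (b - a))%:E); last exact: ltry.
apply: ge_ereal_sup => _ [u [hu gu] <-].
have mfu : measurable_fun setT u by move: hu => [[/sub_Lfun_mfun + _] _]; rewrite inE.
apply: exp_integral_le => //.
- by rewrite lebesgue_measure_itv/= lte_fin ab -EFinD.
- move=> N; rewrite -/r rV; apply: superlevel_exponential_decay => //.
  + exact: ltW.
  + by rewrite -gagliardo_le1.
  + exact: (@sobolev0_support_measure p).
- by rewrite -ler_pdivlMr// ltW.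
Qed.

End SubcriticalBound.

(** * Affine changes of variables *)

Section ChangeOfVariables.
Context {R : realType}.
Local Notation mu := (@lebesgue_measure R).

Definition affine (k d : R) (x : R) : R := k * x + d.

Lemma measurable_affine (k d : R) :
  measurable_fun setT (affine k d : measurableTypeR R -> measurableTypeR R).
Proof. by apply: measurable_funD => //; exact: measurable_funM. Qed.

Lemma affine_preimage_itv (k d a b : R) : k != 0 ->
  (`|k|%:E * mu (affine k d @^-1` `]a, b]) = mu `]a, b]%classic)%E.
Proof.
move=> k0; have [kp|kn] : 0 < k \/ k < 0.
  by case: (ltgtP k 0) k0 => //; [right|left].
- have -> : affine k d @^-1` `]a, b] = `](a - d) / k, (b - d) / k]%classic.
    apply/seteqP; split => x; rewrite /affine/= !in_itv/=;
      by rewrite ltr_pdivrMr// ler_pdivlMr// ltrBlDr lerBrDr mulrC.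
  rewrite !lebesgue_measure_itv/= !lte_fin.
  have -> : ((a - d) / k < (b - d) / k) = (a < b).
    by rewrite ltr_pM2r ?invr_gt0// ltrD2r.
  rewrite gtr0_norm//; case: ifPn => h.
    by rewrite -!EFinB -EFinM; congr EFin; field.
  by rewrite mule0.
- have -> : affine k d @^-1` `]a, b] = `[(b - d) / k, (a - d) / k[%classic.
    apply/seteqP; split => x; rewrite /affine/= !in_itv/=;
      by rewrite ltr_ndivlMr// ler_ndivrMr// ltrBlDr lerBrDr mulrC andbC.
  rewrite !lebesgue_measure_itv/= !lte_fin.
  have -> : ((b - d) / k < (a - d) / k) = (a < b).
    by rewrite ltr_nM2r ?invr_lt0// ltrD2r.
  rewrite ltr0_norm//; case: ifPn => h.
    by rewrite -!EFinB -EFinM; congr EFin; field.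
  by rewrite mule0.
Qed.

(** The image of the Lebesgue measure under an affine map, rescaled by its slope. *)
Definition affine_measure (k d : R) : {measure set (measurableTypeR R) -> \bar R}.
Proof.
refine (mscale (NngNum (normr_ge0 k))
  (pushforward mu (affine k d : _ -> measurableTypeR R))).
exact: measurable_affine.
Defined.

Lemma lebesgue_measure_affine (k d : R) (A : set R) : k != 0 ->
  measurable A -> mu A = affine_measure k d A.
Proof.
move=> k0 mA; apply: lebesgue_measure_unique => //= _ [[a b]] _ <-.
exact/esym/affine_preimage_itv.
Qed.

(** By uniqueness of the Lebesgue measure on half-open intervals, rescaling the
    image measure by |k| gives the Lebesgue measure back. *)
Lemma ge0_integral_affine (k d : R) (f : R -> \bar R) : k != 0 ->
  measurable_fun setT f -> (forall x, 0 <= f x)%E ->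
  (\int[mu]_x f x = `|k|%:E * \int[mu]_x f (k * x + d)%R)%E.
Proof.
move=> k0 mf f0.
have mphi := measurable_affine k d.
transitivity (\int[affine_measure k d]_x f x)%E.
  by apply: eq_measure_integral => // A mA _; exact: lebesgue_measure_affine.
rewrite ge0_integral_mscale//=; congr (_ * _)%E.
by rewrite ge0_integral_pushforward.
Qed.

End ChangeOfVariables.

(** * Exponential changes of variables *)

Section ExponentialSubstitution.
Context {R : realType}.
Local Notation mu := (@lebesgue_measure R).

Lemma derive1_expR : derive1 expR = expR :> (R -> R).
Proof. by apply/funext => x; rewrite derive1E derive_val. Qed.

Lemma derive1_expRN : derive1 (fun x : R => expR (- x)) = (fun x => - expR (- x)).
Proof.
apply/funext => x; rewrite derive1E.
have h : is_derive x 1 (fun x : R => expR (- x)) (expR (- x) * - 1) by apply: is_derive1_comp.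
by rewrite derive_val mulrN1.
Qed.

Lemma derivable_expRN (x : R) : derivable (fun x => expR (- x)) x 1.
Proof.
have h : is_derive x 1 (fun x : R => expR (- x)) (expR (- x) * - 1) by apply: is_derive1_comp.
by case: h.
Qed.

Lemma continuous_expRN : continuous (fun x : R => expR (- x)).
Proof.
move=> x; apply: differentiable_continuous; apply/derivable1_diffP.
exact: derivable_expRN.
Qed.

Lemma derivable_oo_LRcontinuousT (F : R -> R) (a b : R) :
  (forall x, derivable F x 1) -> derivable_oo_LRcontinuous F a b.
Proof.
move=> dF; have cF : continuous F.
  by move=> x; apply: differentiable_continuous; apply/derivable1_diffP.
by split => //; [apply: cvg_at_right_filter|apply: cvg_at_left_filter]; exact: cF.
Qed.

Lemma integral_itv_expR (G : R -> R) (a b : R) : a <= b ->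
  (forall x, expR a <= x <= expR b -> {for x, continuous G}) ->
  (\int[mu]_(x in `[expR a, expR b]) (G x)%:E =
   \int[mu]_(x in `[a, b]) (G (expR x) * expR x)%:E)%E.
Proof.
move=> ab cG.
rewrite (@integration_by_substitution_increasing _ expR G a b) ?derive1_expR//.
- by move=> x y _ _; rewrite ltr_expR.
- by move=> x _; exact: continuous_expR.
- by apply/cvg_ex; exists (expR a); apply: cvg_at_right_filter; exact: continuous_expR.
- by apply/cvg_ex; exists (expR b); apply: cvg_at_left_filter; exact: continuous_expR.
- by apply: derivable_oo_LRcontinuousT => x; exact: derivable_expR.
- apply: continuous_in_subspaceT => x; rewrite inE/= in_itv/=; exact: cG.
Qed.

Lemma integral_itv_expRN (G : R -> R) (a b : R) : a <= b ->
  (forall x, expR (- b) <= x <= expR (- a) -> {for x, continuous G}) ->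
  (\int[mu]_(x in `[expR (- b), expR (- a)]) (G x)%:E =
   \int[mu]_(x in `[a, b]) (G (expR (- x)) * expR (- x))%:E)%E.
Proof.
move=> ab cG.
have cN : continuous (fun x : R => - expR (- x)).
  by move=> x; apply: cvgN; exact: continuous_expRN.
rewrite (@integration_by_substitution_decreasing _ (fun x => expR (- x)) G a b)
  ?derive1_expRN//.
- by apply: eq_integral => x _ /=; rewrite opprK.
- by move=> x y _ _; rewrite ltr_expR ltrN2.
- by apply/cvg_ex; exists (- expR (- a)); apply: cvg_at_right_filter; exact: cN.
- by apply/cvg_ex; exists (- expR (- b)); apply: cvg_at_left_filter; exact: cN.
- by apply: derivable_oo_LRcontinuousT => x; exact: derivable_expRN.
- apply: continuous_in_subspaceT => x; rewrite inE/= in_itv/=; exact: cG.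
Qed.

Let I n : set R := `[n.+1%:R^-1, n.+1%:R].

Let I_bigcup : \bigcup_n I n = `]0, +oo[%classic.
Proof.
apply/seteqP; split => x /=.
  move=> [n _]; rewrite /I/= !in_itv/= andbT => /andP[h _].
  by apply: lt_le_trans h; rewrite invr_gt0.
rewrite in_itv/= andbT => x0.
have [k hk] := ltr_add_invr x0; rewrite add0r in hk.
pose m := Num.trunc x; exists (maxn k m) => //; rewrite /I/= in_itv/=.
apply/andP; split.
  apply: le_trans (ltW hk); rewrite lef_pV2 ?posrE// ler_nat ltnS.
  exact: leq_maxl.
apply: (le_trans (ltW (truncnS_gt x))); rewrite ler_nat ltnS; exact: leq_maxr.
Qed.

Let I_nd n m : (n <= m)%N -> m.+1%:R^-1 <= n.+1%:R^-1 :> R.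
Proof. by move=> nm; rewrite lef_pV2 ?posrE// ler_nat ltnS. Qed.

Let I_nd2 n m : (n <= m)%N -> n.+1%:R <= m.+1%:R :> R.
Proof. by move=> nm; rewrite ler_nat ltnS. Qed.

Let I_le n : n.+1%:R^-1 <= n.+1%:R :> R.
Proof. by apply: (@le_trans _ _ 1); [rewrite invf_le1// ler1n|rewrite ler1n]. Qed.

Lemma integral_bigcup_cvg (F : (set R)^nat) (D : set R) (f : R -> R) :
  (forall n m, (n <= m)%N -> F n `<=` F m) -> (forall n, measurable (F n)) ->
  \bigcup_n F n = D -> measurable_fun setT f -> (forall x, 0 <= f x) ->
  (\int[mu]_(x in F n) (f x)%:E @[n --> \oo] --> \int[mu]_(x in D) (f x)%:E)%E.
Proof.
move=> ndF mF <- mf f0; apply: ge0_nondecreasing_set_cvg_integral => //.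
- by move=> n m nm; apply/subsetPset; exact: ndF.
- by move=> n; apply: measurable_funTS; exact/measurable_EFinP.
- by move=> n x _; rewrite lee_fin.
Qed.

(** The continuous substitution on compact intervals passes to the limit along
    an exhaustion.  The point 1 is left out since the logarithmic kernel is
    singular there. *)
Lemma integral_gt1_expR (G : R -> R) : measurable_fun setT G ->
  (forall x, 0 <= G x) -> (forall x, 1 < x -> {for x, continuous G}) ->
  (\int[mu]_(x in `]1%R, +oo[) (G x)%:E =
   \int[mu]_(x in `]0%R, +oo[) (G (expR x) * expR x)%:E)%E.
Proof.
move=> mG G0 cG.
have mH : measurable_fun setT (fun x => G (expR x) * expR x).
  by apply: measurable_funM => //; exact: measurableT_comp.
have H0 x : 0 <= G (expR x) * expR x by rewrite mulr_ge0// expR_ge0.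
have h1 := @integral_bigcup_cvg I _ _ _ _ I_bigcup mH H0.
have h2 := @integral_bigcup_cvg
  (fun n => `[expR n.+1%:R^-1, expR n.+1%:R]%classic) `]1, +oo[%classic G _ _ _ mG G0.
have e : (fun n => \int[mu]_(x in `[expR n.+1%:R^-1, expR n.+1%:R]) (G x)%:E)%E =
   (fun n => \int[mu]_(x in I n) (G (expR x) * expR x)%:E)%E.
  apply/funext => n; rewrite integral_itv_expR// => x /andP[hx _].
  apply: cG; apply: lt_le_trans hx; by rewrite expR_gt1 invr_gt0.
rewrite e in h2.
apply: (cvg_unique _ (h2 _ _ _) (h1 _ _)) => //.
- move=> n m nm x /=; rewrite !in_itv/= => /andP[h3 h4]; apply/andP; split.
    by apply: le_trans h3; rewrite ler_expR I_nd.
  by apply: (le_trans h4); rewrite ler_expR I_nd2.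
- apply/seteqP; split => x /=.
    move=> [n _ /=]; rewrite !in_itv/= andbT => /andP[h _].
    by apply: lt_le_trans h; rewrite expR_gt1 invr_gt0.
  rewrite in_itv/= andbT => x1.
  have x0 : 0 < x by exact: lt_trans x1.
  have : (\bigcup_n I n) (ln x) by rewrite I_bigcup/= in_itv/= andbT ln_gt0.
  move=> [n _]; rewrite /I/= in_itv/= => /andP[h3 h4]; exists n => //=.
  by rewrite in_itv/= -(lnK (x0 : x \is Num.pos)) !ler_expR h3 h4.
- move=> n m nm x; rewrite /I/= !in_itv/= => /andP[h3 h4]; apply/andP; split.
    exact: le_trans (I_nd nm) h3.
  exact: le_trans h4 (I_nd2 nm).
- by move=> n; exact: measurable_itv.
Qed.

Lemma integral_lt1_expRN (G : R -> R) : measurable_fun setT G ->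
  (forall x, 0 <= G x) -> (forall x, 0 < x < 1 -> {for x, continuous G}) ->
  (\int[mu]_(x in `]0%R, 1%R[) (G x)%:E =
   \int[mu]_(x in `]0%R, +oo[) (G (expR (- x)) * expR (- x))%:E)%E.
Proof.
move=> mG G0 cG.
have mH : measurable_fun setT (fun x : R => G (expR (- x)) * expR (- x)).
  have mE : measurable_fun setT (fun x : R => expR (- x)) by exact: measurableT_comp.
  by apply: measurable_funM => //; exact: measurableT_comp.
have H0 x : 0 <= G (expR (- x)) * expR (- x) by rewrite mulr_ge0// expR_ge0.
have h1 := @integral_bigcup_cvg I _ _ _ _ I_bigcup mH H0.
have h2 := @integral_bigcup_cvg
  (fun n => `[expR (- n.+1%:R), expR (- n.+1%:R^-1)]%classic) `]0, 1[%classic G _ _ _ mG G0.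
have e : (fun n => \int[mu]_(x in `[expR (- n.+1%:R), expR (- n.+1%:R^-1)]) (G x)%:E)%E =
   (fun n => \int[mu]_(x in I n) (G (expR (- x)) * expR (- x))%:E)%E.
  apply/funext => n; rewrite integral_itv_expRN// => x /andP[hx hx'].
  apply: cG; rewrite (lt_le_trans _ hx) ?expR_gt0//=.
  by apply: (le_lt_trans hx'); rewrite expR_lt1 oppr_lt0 invr_gt0.
rewrite e in h2.
apply: (cvg_unique _ (h2 _ _ _) (h1 _ _)) => //.
- move=> n m nm x /=; rewrite !in_itv/= => /andP[h3 h4]; apply/andP; split.
    by apply: le_trans h3; rewrite ler_expR lerN2 I_nd2.
  by apply: (le_trans h4); rewrite ler_expR lerN2 I_nd.
- apply/seteqP; split => x /=.
    move=> [n _ /=]; rewrite !in_itv/= => /andP[h h']; apply/andP; split.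
      by apply: lt_le_trans h; rewrite expR_gt0.
    by apply: (le_lt_trans h'); rewrite expR_lt1 oppr_lt0 invr_gt0.
  rewrite in_itv/= => /andP[x0 x1].
  have : (\bigcup_n I n) (- ln x).
    by rewrite I_bigcup/= in_itv/= andbT oppr_gt0 ln_lt0// x0.
  move=> [n _]; rewrite /I/= in_itv/= => /andP[h3 h4]; exists n => //=.
  by rewrite in_itv/= -(lnK (x0 : x \is Num.pos)) !ler_expR lerNl h4 lerNr h3.
- move=> n m nm x; rewrite /I/= !in_itv/= => /andP[h3 h4]; apply/andP; split.
    exact: le_trans (I_nd nm) h3.
  exact: le_trans h4 (I_nd2 nm).
- by move=> n; exact: measurable_itv.
Qed.

End ExponentialSubstitution.

(** * Series over the odd integers *)

Section OddSeries.
Context {R : realType}.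

(** With y = sqrt x, the factor n y^n is at most the geometric sum 1/(1-y), and
    the remaining factor y^n tends to 0. *)
Lemma cvg_natr_mul_expr (x : R) : 0 < x < 1 ->
  (fun n : nat => n%:R * x ^+ n) @ \oo --> 0.
Proof.
move=> /andP[x0 x1].
pose y := Num.sqrt x.
have y0 : 0 < y by rewrite sqrtr_gt0.
have y1 : y < 1 by rewrite -sqrtr1 ltr_sqrt.
have yx : y ^+ 2 = x by rewrite sqr_sqrtr// ltW.
have hb n : n%:R * y ^+ n <= (1 - y)^-1.
  have h : `|y| < 1 by rewrite gtr0_norm.
  have := @geometric_le_lim R n 1 y ler01 y0 h.
  rewrite mul1r; apply: le_trans.
  rewrite /series/= mulr_natl -[n in _ *+ n]subn0 -sumr_const_nat.
  apply: ler_sum_nat => i /andP[_ ni].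
  by rewrite mul1r; apply: ler_wiXn2l; [exact: ltW|exact: ltW|exact: ltnW].
have lim0 : (fun n => (1 - y)^-1 * y ^+ n) @ \oo --> 0.
  by apply: cvg_geometric; rewrite gtr0_norm.
apply: (squeeze_cvgr _ _ lim0); last exact: cvg_cst.
apply: nearW => n; rewrite mulr_ge0 ?exprn_ge0 ?(ltW x0)//=.
rewrite -yx -exprM mulnC exprM expr2 mulrA.
by rewrite ler_wpM2r ?hb// exprn_ge0// ltW.
Qed.

Lemma odd_geometric_partial (x : R) N : x != 1 ->
  \sum_(0 <= k < N) (1 + 2 * k)%:R * x ^+ k =
  (1 + x - (1 + 2 * N)%:R * x ^+ N + ((2 * N)%:R - 1) * x ^+ N.+1) / (1 - x) ^+ 2.
Proof.
move=> x1; have x0 : 1 - x != 0 by rewrite subr_eq0 eq_sym.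
elim: N => [|N IH].
  by rewrite big_geq// muln0 addn0 expr0 expr1 mul1r; field.
rewrite big_nat_recr//= IH [x ^+ N.+2]exprS [x ^+ N.+1]exprS mulnS.
have -> : (2 + 2 * N)%:R = 2 + (2 * N)%:R :> R by rewrite natrD.
have -> : (1 + (2 + 2 * N))%:R = 3 + (2 * N)%:R :> R by rewrite addnA natrD.
have -> : (1 + 2 * N)%:R = 1 + (2 * N)%:R :> R by rewrite natrD.
set X := x ^+ N; set n : R := (2 * N)%:R.
by field.
Qed.

Lemma cvg_odd_geometric (x : R) : 0 < x < 1 ->
  (fun N => \sum_(0 <= k < N) (1 + 2 * k)%:R * x ^+ k) @ \oo -->
  (1 + x) / (1 - x) ^+ 2.
Proof.
move=> /[dup] x01 /andP[x0 x1].
have -> : (fun N => \sum_(0 <= k < N) (1 + 2 * k)%:R * x ^+ k) =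
  (fun N => (1 + x - (x ^+ N + 2 * (N%:R * x ^+ N)) +
    (2 * x * (N%:R * x ^+ N) - x * x ^+ N)) / (1 - x) ^+ 2).
  apply/funext => N; rewrite odd_geometric_partial ?lt_eqF//; congr (_ / _).
  have -> : (1 + 2 * N)%:R = 1 + 2 * N%:R :> R by rewrite natrD natrM.
  by rewrite exprS natrM; ring.
have c1 := cvg_natr_mul_expr x01.
have c2 : (fun N : nat => x ^+ N) @ \oo --> 0.
  by apply: cvg_expr; rewrite gtr0_norm.
have -> : (1 + x) / (1 - x) ^+ 2 =
   (1 + x - (0 + 2 * 0) + (2 * x * 0 - x * 0)) / (1 - x) ^+ 2.
  by rewrite !mulr0 addr0 !subr0 addr0.
apply: cvgM; last exact: cvg_cst.
apply: cvgD; first apply: cvgB; first exact: cvg_cst.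
  by apply: cvgD => //; apply: cvgM => //; exact: cvg_cst.
by apply: cvgB; apply: cvgM => //; exact: cvg_cst.
Qed.

(** Both sides equal 2q (1 + q^2) / (1 - q^2)^2; the partial sums of the series
    have a closed form. *)
Lemma odd_kernel_series (q : R) : 0 < q < 1 ->
  (\sum_(k <oo) (2 * (1 + 2 * k)%:R * q ^+ (1 + 2 * k))%:E =
    (q / (1 - q) ^+ 2 + q / (1 + q) ^+ 2)%:E)%E.
Proof.
move=> /andP[q0 q1].
have q2 : 0 < q ^+ 2 < 1 by rewrite exprn_gt0//= exprn_ilt1// ltW.
apply: cvg_lim => //.
have -> : (fun n => \sum_(0 <= k < n) (2 * (1 + 2 * k)%:R * q ^+ (1 + 2 * k))%:E)%E =
   EFin \o (fun n => 2 * q * (\sum_(0 <= k < n) (1 + 2 * k)%:R * (q ^+ 2) ^+ k)).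
  apply/funext => n /=; rewrite sumEFin mulr_sumr; congr EFin.
  by apply: eq_bigr => k _; rewrite add1n exprS exprM; ring.
apply: cvg_EFin; first by apply: nearW.
have -> : q / (1 - q) ^+ 2 + q / (1 + q) ^+ 2 =
   2 * q * ((1 + q ^+ 2) / (1 - q ^+ 2) ^+ 2).
  have n1 : 1 - q != 0 by rewrite gt_eqF// subr_gt0.
  have n2 : 1 + q != 0 by rewrite gt_eqF// addr_gt0.
  have n3 : 1 - q ^+ 2 != 0 by rewrite gt_eqF// subr_gt0; case/andP: q2.
  by field; rewrite n1 n2 n3.
by apply: cvgM; [exact: cvg_cst|exact: cvg_odd_geometric].
Qed.

(** A discrete form of the integral of t^(-a-1), from
    (1 - h)^(-a) >= 1 + a h, itself a consequence of ln (1 - h) <= - h. *)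
Lemma powR_telescope (a m : R) : 0 < a -> 2 < m ->
  2 * a * m `^ (- (a + 1)) <= (m - 2) `^ (- a) - m `^ (- a).
Proof.
move=> a0 m2; have m0 : 0 < m by lra.
pose h := 2 / m.
have h0 : 0 < h by rewrite divr_gt0.
have h1 : h < 1 by rewrite ltr_pdivrMr; lra.
have -> : m - 2 = m * (1 - h) by rewrite mulrBr mulr1 mulrC divfK// gt_eqF.
rewrite powRM; [|exact: ltW|by rewrite subr_ge0 ltW].
have -> : 2 * a * m `^ (- (a + 1)) = m `^ (- a) * (a * h).
  rewrite opprD powRD ?(gt_eqF m0) ?implybT// powR_inv1 ?(ltW m0)// /h; ring.
rewrite -[X in _ <= _ - X]mulr1 -mulrBr ler_wpM2l ?powR_ge0//.
rewrite lerBrDl /powR gt_eqF ?subr_gt0//.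
apply: le_trans (expR_ge1Dx _); rewrite lerD2l mulNr -mulrN ler_wpM2l ?(ltW a0)//.
by rewrite lerNr; apply: le_ln1Dx; rewrite ltrN2.
Qed.

Lemma is_cvg_odd_zeta (p : R) : 1 < p ->
  cvgn (series (fun k : nat => 1 / ((1 + 2 * k)%:R `^ p) : R)).
Proof.
move=> p1; pose a := p - 1.
have a0 : 0 < a by rewrite subr_gt0.
apply: nondecreasing_is_cvgn.
  apply/nondecreasing_seqP => n; rewrite /series/= big_nat_recr//= lerDl.
  by rewrite divr_ge0// powR_ge0.
exists (1 + (2 * a)^-1) => _ [n _ <-]; rewrite /series/=.
case: n => [|n]; first by rewrite big_geq// addr_ge0// invr_ge0 mulr_ge0// ltW.
rewrite big_nat_recl//= muln0 addn0 powR1 divr1 lerD2l.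
apply: (@le_trans _ _ (\sum_(0 <= k < n)
   (2 * a)^-1 * ((1 + 2 * k)%:R `^ (- a) - (1 + 2 * k.+1)%:R `^ (- a)))).
  apply: ler_sum => k _; rewrite div1r ler_pdivlMl ?mulr_gt0//.
  have -> : ((1 + 2 * k.+1)%:R `^ p)^-1 = (1 + 2 * k.+1)%:R `^ (- (a + 1)) :> R.
    by rewrite powRN subrK.
  have -> : (1 + 2 * k)%:R = (1 + 2 * k.+1)%:R - 2 :> R.
    apply/eqP; rewrite eq_sym subr_eq -natrD; apply/eqP; congr (_%:R).
    by rewrite mulnS addnA addnAC.
  by apply: powR_telescope => //; rewrite (ltr_nat _ 2) mulnS.
rewrite -mulr_sumr -[leRHS]mulr1 ler_wpM2l ?invr_ge0 ?mulr_ge0 ?(ltW a0)//.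
under eq_bigr => k _ do rewrite -opprB.
rewrite sumrN telescope_sumr// opprB muln0 addn0 powR1.
by rewrite lerBlDr lerDl powR_ge0.
Qed.

End OddSeries.

(** * The logarithmic kernel and the constant gamma_s *)

Section GammaAndKappa.
Context {R : realType}.
Local Notation mu := (@lebesgue_measure R).
Local Notation D := (`]0%R, +oo[%classic : set R).
Implicit Types (p c x z : R).

Let mD : measurable D. Proof. exact: measurable_itv. Qed.

Lemma measurable_gamma_integrand p c :
  measurable_fun setT (fun t : R => t `^ p * expR (- (c * t))).
Proof.
apply: measurable_funM => //.
have h : measurable_fun setT (fun t : R => - (c * t)).
  by apply: measurableT_comp => //; exact: measurable_funM.
by apply: measurableT_comp.
Qed.

(** The power t^p is at most (2p)^p exp(t/2), and exp(-t/2) is integrable, being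
    proportional to an exponential density. *)
Lemma gamma_integral_lty p : 0 < p ->
  (\int[mu]_(t in D) (t `^ p * expR (- t))%:E < +oo)%E.
Proof.
move=> p0; pose C := (2 * p) `^ p.
have r0 : (0 : R) < 2^-1 by [].
have C0 : 0 <= 2 * C by rewrite mulr_ge0// powR_ge0.
have mP := @measurable_exponential_pdf R 2^-1.
have mPC : measurable_fun setT (fun t => (2 * C * exponential_pdf 2^-1 t)%:E).
  by apply/measurable_EFinP; exact: measurable_funM.
have P0 t := @exponential_pdf_ge0 R 2^-1 (ltW r0) t.
have mG : measurable_fun D (fun t : R => (t `^ p * expR (- t))%:E).
  apply/measurable_EFinP; apply: measurable_funTS.
  have := measurable_gamma_integrand p 1.
  by under eq_fun do rewrite mul1r.
apply: (@le_lt_trans _ _ (2 * C)%:E); last exact: ltry.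
have <- : (\int[mu]_t (2 * C * exponential_pdf 2^-1 t)%:E = (2 * C)%:E)%E.
  under eq_integral do rewrite EFinM.
  rewrite ge0_integralZl_EFin//; [|by move=> t _; rewrite lee_fin|exact/measurable_EFinP].
  by rewrite integral_exponential_pdf// mule1.
apply: (@le_trans _ _ (\int[mu]_(t in D) (2 * C * exponential_pdf 2^-1 t)%:E)%E).
  apply: ge0_le_integral => //.
  - by move=> t _; rewrite lee_fin mulr_ge0// ?powR_ge0 ?expR_ge0.
  - exact: measurable_funTS.
  move=> t; rewrite /= in_itv/= andbT => t0; rewrite lee_fin.
  rewrite /exponential_pdf patchE mem_set/= ?in_itv/= ?andbT ?(ltW t0)//.
  have -> : 2 * C * (2^-1 * expR (- 2^-1 * t)) = C * expR (- 2^-1 * t) by field.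
  have p2 : 0 < 2 * p by rewrite mulr_gt0.
  have h : t `^ p <= C * expR (t / 2).
    have -> : t / 2 = (t / (2 * p)) * p by field; rewrite gt_eqF.
    rewrite expRM -powRM ?expR_ge0 ?(ltW p2)//.
    apply: ge0_ler_powR; [exact: ltW|exact: ltW|
      by rewrite nnegrE mulr_ge0 ?expR_ge0// ltW|].
    rewrite mulrC -ler_pdivrMr//; apply: le_trans (expR_ge1Dx _).
    by rewrite lerDr.
  apply: (@le_trans _ _ (C * expR (t / 2) * expR (- t))).
    by rewrite ler_wpM2r ?expR_ge0.
  by rewrite -mulrA -expRD le_eqVlt; apply/orP; left; apply/eqP; congr (_ * expR _); field.
apply: ge0_subset_integral => //.
by move=> t _; rewrite lee_fin mulr_ge0.
Qed.

Lemma integral_Gamma p : 0 < p ->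
  (\int[mu]_(t in D) (t `^ p * expR (- t))%:E = (Gamma (p + 1))%:E)%E.
Proof.
move=> p0; rewrite /Gamma addrK /Rintegral fineK// ge0_fin_numE.
  exact: gamma_integral_lty.
by apply: integral_ge0 => t _; rewrite lee_fin mulr_ge0 ?powR_ge0 ?expR_ge0.
Qed.

Lemma integral_Gamma_scaled p c : 0 < p -> 0 < c ->
  (\int[mu]_(z in D) (z `^ p * expR (- (c * z)))%:E =
   (c `^ (- (p + 1)) * Gamma (p + 1))%:E)%E.
Proof.
move=> p0 c0; rewrite [RHS]EFinM -integral_Gamma//.
have mG : measurable_fun D (fun t : R => (t `^ p * expR (- t))%:E).
  apply/measurable_EFinP; apply: measurable_funTS.
  have := measurable_gamma_integrand p 1.
  by under eq_fun do rewrite mul1r.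
have mGc : measurable_fun D (fun t : R => (t `^ p * expR (- (c * t)))%:E).
  by apply/measurable_EFinP; apply: measurable_funTS; exact: measurable_gamma_integrand.
pose f := (fun t : R => (t `^ p * expR (- t))%:E) \_ D.
have f0 t : (0 <= f t)%E.
  by apply: erestrict_ge0 => x _; rewrite lee_fin mulr_ge0 ?powR_ge0 ?expR_ge0.
have mf : measurable_fun setT f by apply/(measurable_restrictT _ mD).
rewrite [in RHS]integral_mkcond -/f (@ge0_integral_affine _ c 0 f) ?gt_eqF//.
have -> : (fun x => f (c * x + 0)) =
    (fun t : R => ((c `^ p)%:E * (t `^ p * expR (- (c * t)))%:E)%E) \_ D.
  apply/funext => t; rewrite /f !patchE addr0.
  have -> : (c * t \in D) = (t \in D).
    by apply/idP/idP; rewrite !inE/= !in_itv/= !andbT pmulr_rgt0.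
  case: ifPn => //; rewrite inE/= in_itv/= andbT => t0.
  by rewrite -EFinM mulrA -powRM ?ltW.
rewrite -integral_mkcond ge0_integralZl_EFin ?powR_ge0//; last first.
  by move=> t _; rewrite lee_fin mulr_ge0 ?powR_ge0 ?expR_ge0.
rewrite gtr0_norm// !muleA -!EFinM.
have -> : c `^ (- (p + 1)) * c * c `^ p = 1.
  rewrite -{2}(powRr1 (ltW c0)) -!powRD ?(gt_eqF c0) ?implybT//.
  by rewrite (_ : - (p + 1) + 1 + p = 0) ?powRr0//; ring.
by rewrite mul1e.
Qed.

Lemma integral_even_split (f : R -> \bar R) : measurable_fun setT f ->
  (forall x, 0 <= f x)%E ->
  (\int[mu]_x f x = \int[mu]_(x in D) (f x + f (- x)%R))%E.
Proof.
move=> mf f0.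
have mN : measurable_fun setT (fun x => f (- x)) by exact: measurableT_comp.
have -> : (\int[mu]_x f x = \int[mu]_(x in D `|` `]-oo, 0%R]) f x)%E.
  congr (integral _ _ _); apply/esym/seteqP; split => // x _ /=.
  rewrite !in_itv/= andbT; have [h|h] := ltP 0 x; [by left|by right].
rewrite ge0_integral_setU//; last 2 first.
- by apply: measurable_funTS.
- rewrite disj_set2E; apply/eqP/seteqP; split => // x [] /=.
  by rewrite !in_itv/= andbT => h; rewrite leNgt h.
rewrite ge0_integralD//; last 2 first.
- exact: measurable_funTS.
- exact: measurable_funTS.
congr (_ + _)%E.
have := @ge0_integration_by_substitution0 R (fun x => f (- x)) mN (fun r => f0 _).
under [X in _ = X -> _]eq_integral do rewrite opprK.
by move=> <-; rewrite integral_itv_obnd_cbnd//; exact: measurable_funTS.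
Qed.

Lemma integral_split1 (f : R -> R) : measurable_fun setT f ->
  (forall x, 0 <= f x) ->
  (\int[mu]_(x in D) (f x)%:E = \int[mu]_(x in `]0%R, 1%R[) (f x)%:E
     + \int[mu]_(x in `]1%R, +oo[) (f x)%:E)%E.
Proof.
move=> mf f0.
have mfE : measurable_fun setT (EFin \o f) by exact/measurable_EFinP.
have -> : D = `]0%R, 1%R[%classic `|` `[1%R, +oo[%classic.
  apply/seteqP; split => x /=; rewrite !in_itv/= !andbT.
    by move=> ->; have [h|h] := ltP x 1; [left|right].
  by move=> [/andP[]//|]; exact: lt_le_trans.
rewrite ge0_integral_setU//; last 3 first.
- by apply: measurable_funTS.
- by move=> x _; rewrite lee_fin.
- rewrite disj_set2E; apply/eqP/seteqP; split => // x [] /=.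
  by rewrite !in_itv/= andbT => /andP[_ h]; rewrite leNgt h.
by rewrite -[in LHS](@integral_itv_obnd_cbnd R 1)//; exact: measurable_funTS.
Qed.

(** The integrand of the energy of ln | | with one variable fixed at 1; dilations
    reduce any other value of that variable to this one. *)
Definition log_kernel p x : R := `|ln `|x| | `^ p / `|x - 1| ^+ 2.

Lemma log_kernel_ge0 p x : 0 <= log_kernel p x.
Proof. by rewrite divr_ge0// powR_ge0. Qed.

Lemma measurable_log_kernel p : measurable_fun setT (log_kernel p).
Proof.
apply: measurable_ratio_ge0 => [x||].
- exact: exprn_ge0.
- apply: (measurableT_comp (measurable_powR p)).
  by apply: measurableT_comp => //; exact: measurableT_comp.
- apply: measurable_funX; apply: measurableT_comp => //.
  exact: measurable_funB.
Qed.

Lemma continuous_log_kernel p x : x != 0 -> `|x| != 1 ->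
  {for x, continuous (log_kernel p)}.
Proof.
move=> x0 x1; apply: continuousM.
- have l0 : 0 < `|ln `|x| |.
    by rewrite normr_gt0 ln_eq0 ?normr_gt0.
  apply: (@continuous_comp _ _ _ (fun y : R => `|ln `|y| | : R) (fun a : R => a `^ p)).
    apply: (@continuous_comp _ _ _ (fun y : R => ln `|y|) (fun y : R => `|y| : R)).
      apply: (@continuous_comp _ _ _ (fun y : R => `|y| : R) (@ln R)).
        exact: norm_continuous.
      by apply: continuous_ln; rewrite normr_gt0.
    exact: norm_continuous.
  apply: differentiable_continuous; apply/derivable1_diffP.
  by apply: derivable_powR; rewrite in_itv/= andbT.
- apply: continuousV.
    rewrite expf_eq0/= normr_eq0 subr_eq0; apply: contra x1 => /eqP ->.
    by rewrite normr1.
  apply: (@continuous_comp _ _ _ (fun y : R => `|y - 1| : R) (fun a : R => a ^+ 2)).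
    apply: (@continuous_comp _ _ _ (fun y : R => y - 1) (fun y : R => `|y| : R)).
      by apply: continuousB => //; exact: cst_continuous.
    exact: norm_continuous.
  exact: exprn_continuous.
Qed.

Definition kappa p : \bar R := (\int[mu]_x (log_kernel p x)%:E)%E.

(** This is 1 / (4 sinh^2 (z/2)) + 1 / (4 cosh^2 (z/2)). *)
Definition hyperbolic_kernel z : R :=
  expR (- z) / (1 - expR (- z)) ^+ 2 + expR (- z) / (1 + expR (- z)) ^+ 2.

(** In the variable z = |ln |rho||, the four intervals cut by -1, 0 and 1
    contribute through (rho - 1)^-2 + (rho + 1)^-2; the map rho -> 1/rho
    exchanges the intervals (0, 1) and (1, +oo), whence two equal halves. *)
Lemma kappa_split p : 0 < p ->
  kappa p = (\int[mu]_(z in D) (z `^ p * hyperbolic_kernel z)%:E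
    + \int[mu]_(z in D) (z `^ p * hyperbolic_kernel z)%:E)%E.
Proof.
move=> p0; pose g x := log_kernel p x + log_kernel p (- x).
have mh := @measurable_log_kernel p.
have mg : measurable_fun setT g.
  by apply: measurable_funD => //; exact: measurableT_comp.
have g0 x : 0 <= g x by rewrite addr_ge0// log_kernel_ge0.
have cg x : 0 < x -> x != 1 -> {for x, continuous g}.
  move=> x0 x1.
  have xN : `|x| != 1 by rewrite gtr0_norm.
  apply: continuousD.
    by apply: continuous_log_kernel => //; rewrite gt_eqF.
  apply: (@continuous_comp _ _ _ (fun y : R => - y) (log_kernel p)).
    by apply: continuousN => //.
  by apply: continuous_log_kernel; rewrite ?normrN// oppr_eq0 gt_eqF.
rewrite /kappa integral_even_split//; last 2 first.
- exact/measurable_EFinP.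
- by move=> x; rewrite lee_fin log_kernel_ge0.
under eq_integral do rewrite -EFinD.
rewrite integral_split1// integral_gt1_expR//; last first.
  by move=> x x1; apply: cg; [exact: lt_trans x1|rewrite gt_eqF].
rewrite integral_lt1_expRN//; last first.
  by move=> x /andP[x0 x1]; apply: cg; rewrite // lt_eqF.
congr (_ + _)%E; apply: eq_integral => z; rewrite inE/= in_itv/= andbT => z0;
  congr EFin.
- rewrite /g /log_kernel normrN (ger0_norm (expR_ge0 _)) expRK normrN (gtr0_norm z0).
  rewrite -mulrDr -mulrA /hyperbolic_kernel; congr (_ * _).
  rewrite !real_normK ?num_real//.
  set q := expR (- z).
  have q1 : q < 1 by rewrite expR_lt1 oppr_lt0.
  have q0 : 0 < q by exact: expR_gt0.
  by field; apply/and4P; split; [rewrite gt_eqF|rewrite gt_eqF|rewrite lt_eqF|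
    rewrite lt_eqF]; lra.
- rewrite /g /log_kernel normrN (ger0_norm (expR_ge0 _)) expRK (gtr0_norm z0).
  rewrite -mulrDr -mulrA /hyperbolic_kernel; congr (_ * _).
  rewrite !real_normK ?num_real// expRN.
  set e := expR z.
  have e1 : 1 < e by rewrite expR_gt1.
  by field; apply/and4P; split; [rewrite gt_eqF|rewrite gt_eqF|rewrite gt_eqF|
    rewrite lt_eqF]; lra.
Qed.

Lemma integral_hyperbolic_kernel p : 1 < p ->
  (\int[mu]_(z in D) (z `^ p * hyperbolic_kernel z)%:E =
   (2 * Gamma (p + 1) *
     limn (series (fun k : nat => 1 / ((1 + 2 * k)%:R `^ p) : R)))%:E)%E.
Proof.
move=> p1; have p0 : 0 < p by lra.
pose f k z := (z `^ p * (2 * (1 + 2 * k)%:R * expR (- z) ^+ (1 + 2 * k)))%:E.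
have fE k z : f k z =
    ((2 * (1 + 2 * k)%:R)%:E * (z `^ p * expR (- ((1 + 2 * k)%:R * z)))%:E)%E.
  by rewrite /f -EFinM -mulrN expRM_natl; congr EFin; ring.
have mG k : measurable_fun D (fun z : R => (z `^ p * expR (- ((1 + 2 * k)%:R * z)))%:E).
  by apply/measurable_EFinP; apply: measurable_funTS; exact: measurable_gamma_integrand.
have mf k : measurable_fun D (f k).
  by rewrite (funext (fE k)); exact: measurable_funeM.
have f0 k z : (0 <= f k z)%E.
  by rewrite lee_fin !mulr_ge0 ?powR_ge0// exprn_ge0// expR_ge0.
transitivity (\int[mu]_(z in D) (\sum_(k <oo) f k z))%E.
  apply: eq_integral => z; rewrite inE/= in_itv/= andbT => z0.
  rewrite EFinM -odd_kernel_series; last first.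
    by rewrite expR_gt0 expR_lt1 oppr_lt0.
  rewrite -nneseriesZl; first by apply: eq_eseriesr => k _; rewrite -EFinM.
  by move=> k _; rewrite lee_fin !mulr_ge0// exprn_ge0// expR_ge0.
rewrite integral_nneseries//.
have intf k : (\int[mu]_(z in D) f k z = (2 * (1 + 2 * k)%:R)%:E *
    ((1 + 2 * k)%:R `^ (- (p + 1)) * Gamma (p + 1))%:E)%E.
  rewrite (funext (fE k)) ge0_integralZl_EFin ?integral_Gamma_scaled//.
    by move=> z _; rewrite lee_fin mulr_ge0 ?powR_ge0 ?expR_ge0.
  exact: mG.
rewrite (eq_eseriesr (fun k _ => intf k)).
apply: cvg_lim => //.
have -> : (fun n => \sum_(0 <= k < n) ((2 * (1 + 2 * k)%:R)%:E *
   ((1 + 2 * k)%:R `^ (- (p + 1)) * Gamma (p + 1))%:E))%E =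
   EFin \o (fun n => 2 * Gamma (p + 1) *
      series (fun k : nat => 1 / ((1 + 2 * k)%:R `^ p) : R) n).
  apply/funext => n /=; under eq_bigr do rewrite -EFinM.
  rewrite sumEFin; congr EFin; rewrite /series/= mulr_sumr.
  apply: eq_bigr => k _; set m : R := (1 + 2 * k)%:R.
  have m0 : 0 < m by rewrite ltr0n.
  rewrite opprD powRD ?(gt_eqF m0) ?implybT// powR_inv1 ?(ltW m0)// powRN.
  have w0 : 0 < m `^ p by exact: powR_gt0.
  by clearbody m; field; rewrite (gt_eqF m0) (gt_eqF w0).
apply: cvg_EFin; first by apply: nearW.
by apply: cvgM; [exact: cvg_cst|exact: is_cvg_odd_zeta].
Qed.

Theorem kappa_gamma_s p : 1 < p -> kappa p = (gamma_s p / 2)%:E.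
Proof.
move=> p1; have p0 : 0 < p by lra.
rewrite kappa_split// integral_hyperbolic_kernel// -EFinD /gamma_s; congr EFin.
by field.
Qed.

End GammaAndKappa.

(** * Smooth truncated logarithms *)

Section SmoothBump.
Context {R : realType}.
Implicit Types (f g : R -> R) (x v : R) (k : nat).

(** Powers of 1/v are included so that the family is closed under derivation up
    to linear combinations. *)
Definition flat k v : R := if 0 < v then v ^- k * expR (- v^-1) else 0.

Lemma flat_gt0 k v : 0 < v -> flat k v = v ^- k * expR (- v^-1).
Proof. by rewrite /flat => ->. Qed.

Lemma flat_le0 k v : v <= 0 -> flat k v = 0.
Proof. by rewrite /flat ltNge => ->. Qed.

(** The exponential exp(1/v) dominates its Taylor term of degree k+2. *)
Lemma flat_le_sqr k v : `|flat k v| <= k.+2`!%:R * v ^+ 2.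
Proof.
have [v0|v0] := leP v 0; first by rewrite flat_le0// normr0 mulr_ge0// sqr_ge0.
have w0 : 0 < v^-1 by rewrite invr_gt0.
rewrite flat_gt0// ger0_norm ?mulr_ge0 ?expR_ge0 ?invr_ge0 ?exprn_ge0 ?(ltW v0)//.
rewrite expRN ler_pdivrMr ?expR_gt0//.
have h := @expR_ge1Dxn R v^-1 k.+1 (ltW w0).
have h2 : v^-1 ^+ k.+2 / k.+2`!%:R <= expR v^-1.
  by apply: le_trans h; rewrite lerDr.
have f0 : 0 < k.+2`!%:R :> R by rewrite ltr0n fact_gt0.
rewrite ler_pdivrMr// in h2.
have -> : v ^- k = v ^+ 2 * v^-1 ^+ k.+2.
  rewrite -[k.+2]addn2 exprD exprVn mulrCA exprVn mulrV ?mulr1//.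
  by rewrite unitfE expf_eq0/= gt_eqF.
rewrite [leRHS](_ : _ = v ^+ 2 * (expR v^-1 * k.+2`!%:R)); last by ring.
by rewrite ler_wpM2l ?sqr_ge0.
Qed.

Lemma is_derive_sqr_bound f (C : R) : (forall x, `|f x| <= C * x ^+ 2) ->
  is_derive (0 : R) (1 : R) f (0 : R).
Proof.
move=> hf.
have f0 : f 0 = 0 by apply/eqP; rewrite -normr_le0 (le_trans (hf 0))// expr0n/= mulr0.
have C0 : 0 <= C by have := hf 1; rewrite expr1n mulr1; exact: le_trans.
have h : (fun h : R => h^-1 *: (f (h *: (1 : R) + 0) - f 0)) @ 0^' --> (0 : R).
  apply/cvgr0Pnorm_le => e e0; near=> t.
  have t0 : t != 0 by near: t; exact: nbhs_dnbhs_neq.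
  rewrite addr0 f0 subr0 normrZ normfV scaler1.
  rewrite ler_pdivrMl ?normr_gt0//.
  apply: (le_trans (hf t)).
  have -> : C * t ^+ 2 = `|t| * (C * `|t|).
    by rewrite [RHS]mulrCA -expr2 real_normK ?num_real.
  rewrite ler_wpM2l//.
  have : `|t| <= e / (C + 1).
    near: t; apply: dnbhs0_le; rewrite divr_gt0// ltr_wpDl//.
  move=> ht; apply: (@le_trans _ _ (C * (e / (C + 1)))); first by rewrite ler_wpM2l.
  rewrite mulrA ler_pdivrMr ?ltr_wpDl// mulrC ler_wpM2l ?(ltW e0)//.
  by rewrite lerDl.
have d0 : derivable f 0 1 by apply/cvg_ex; exists 0; exact: h.
by apply: (DeriveDef d0); exact/cvg_lim.
Unshelve. all: by end_near.
Qed.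

Lemma is_derive_flat k v :
  is_derive v 1 (flat k) (- k%:R * flat k.+1 v + flat k.+2 v).
Proof.
have [v0|v0|->] := ltgtP v 0; last first.
- rewrite !flat_le0// mulr0 addr0.
  apply: (@is_derive_sqr_bound _ k.+2`!%:R) => x; exact: flat_le_sqr.
- apply: (@near_eq_is_derive _ _ _ (fun y : R => (y ^+ k)^-1 * expR (- y^-1))).
    near=> y; rewrite flat_gt0//; near: y; exact: lt_nbhsr.
  have vn0 : v != 0 by rewrite gt_eqF.
  have d0 : is_derive v 1 (fun y : R => y^-1) (- v ^- 2 *: 1).
    exact: (@is_deriveV _ id v 1 1 vn0 (is_derive_id _ _)).
  have d1 : is_derive v 1 (fun y : R => y ^- k) ((k%:R * v^-1 ^+ k.-1) *: (- v ^- 2 *: 1)).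
    have -> : (fun y : R => y ^- k) = ((fun y : R => y^-1) : R -> R) ^+ k.
      by apply/funext => y; rewrite exprfctE exprVn.
    exact: is_deriveX.
  have d2 : is_derive v 1 (fun y : R => expR (- y^-1)) (expR (- v^-1) * - (- v ^- 2 *: 1)).
    exact: is_derive1_comp.
  have d3 := is_deriveM d1 d2.
  apply: (is_derive_eq d3).
  rewrite !flat_gt0//= /GRing.scale/= -!exprVn; set w := v^-1; set e := expR _.
  case: (k) => [|j]; first by rewrite !expr0 mulr0n; ring.
  rewrite /= [w ^+ j.+3]exprS [w ^+ j.+2]exprS [w ^+ j.+1]exprS.
  by move: (w ^+ j) (j.+1%:R : R) => X n; ring.
- rewrite !flat_le0 ?(ltW v0)// mulr0 addr0.
  apply: (@near_eq_is_derive _ _ _ (fun=> 0)).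
    near=> y; rewrite flat_le0//; apply: ltW; near: y; exact: lt_nbhsl.
Unshelve. all: by end_near.
Qed.
(** An inductive class of functions that contains the truncated logarithm and
    the derivatives of all its members: smoothness then needs no analysis of
    higher derivatives. *)
Inductive elementary (e : R) : (R -> R) -> Prop :=
| elementary_cst c : elementary e (fun=> c)
| elementary_id : elementary e id
| elementary_flat k : elementary e (flat k)
| elementary_ln : elementary e (fun x => ln (x ^+ 2 + e))
| elementary_inv : elementary e (fun x => (x ^+ 2 + e)^-1)
| elementary_add f g : elementary e f -> elementary e g ->
    elementary e (fun x => f x + g x)
| elementary_mul f g : elementary e f -> elementary e g ->
    elementary e (fun x => f x * g x)
| elementary_comp f g : elementary e f -> elementary e g ->
    elementary e (fun x => f (g x)).

Lemma is_derive_sqrDr (e : R) x : is_derive x 1 (fun y : R => y ^+ 2 + e) (2 * x).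
Proof.
have d1 : is_derive x 1 (fun y : R => y ^+ 2) ((2%:R * x ^+ 1) *: 1).
  exact: (@is_deriveX _ _ id 2 x 1 1 (is_derive_id _ _)).
have d2 := is_deriveD d1 (is_derive_cst e x 1).
by apply: (is_derive_eq d2); rewrite /GRing.scale/= addr0 mulr1 expr1.
Qed.

Lemma elementary_derive (e : R) f : 0 < e -> elementary e f ->
  exists2 f', elementary e f' & forall x, is_derive x 1 f (f' x).
Proof.
move=> e0; have q0 x : 0 < x ^+ 2 + e by rewrite ltr_wpDl ?sqr_ge0.
elim=> [c||k|||{}f g _ [f' ef' df] _ [g' eg' dg]|{}f g ef [f' ef' df] eg [g' eg' dg]
  |{}f g ef [f' ef' df] eg [g' eg' dg]].
- by exists (fun=> 0); [exact: elementary_cst|move=> x; exact: is_derive_cst].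
- by exists (fun=> 1); [exact: elementary_cst|move=> x; exact: is_derive_id].
- exists (fun v => - k%:R * flat k.+1 v + flat k.+2 v); last exact: is_derive_flat.
  apply: elementary_add; last exact: elementary_flat.
  by apply: elementary_mul; [exact: elementary_cst|exact: elementary_flat].
- exists (fun x => (x ^+ 2 + e)^-1 * (2 * x)).
    apply: elementary_mul; first exact: elementary_inv.
    by apply: elementary_mul; [exact: elementary_cst|exact: elementary_id].
  move=> x; apply: (@is_derive1_comp _ (@ln R) (fun y => y ^+ 2 + e)).
    exact: is_derive1_ln.
  exact: is_derive_sqrDr.
- exists (fun x => (-1) * ((x ^+ 2 + e)^-1 * (x ^+ 2 + e)^-1) * (2 * x)).
    apply: elementary_mul.
      apply: elementary_mul; first exact: elementary_cst.
      by apply: elementary_mul; exact: elementary_inv.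
    by apply: elementary_mul; [exact: elementary_cst|exact: elementary_id].
  move=> x; have qx : x ^+ 2 + e != 0 by rewrite gt_eqF.
  have d := @is_deriveV _ (fun y : R => y ^+ 2 + e) x _ 1 qx (is_derive_sqrDr e x).
  by apply: (is_derive_eq d); rewrite mulN1r -expr2 exprVn.
- exists (fun x => f' x + g' x); first exact: elementary_add.
  by move=> x; exact: is_deriveD.
- exists (fun x => f x * g' x + g x * f' x).
    by apply: elementary_add; exact: elementary_mul.
  by move=> x; exact: is_deriveM.
- exists (fun x => f' (g x) * g' x).
    apply: elementary_mul => //; exact: elementary_comp.
  by move=> x; exact: is_derive1_comp.
Qed.

Lemma elementary_smooth (e : R) f n x : 0 < e -> elementary e f ->
  derivable (derive1n n f) x 1.
Proof.
move=> e0 ef; have : elementary e (derive1n n f).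
  elim: n => [//|n /(elementary_derive e0)[f' ef' df']].
  rewrite derive1nS; have -> : derive1 (derive1n n f) = f' => //.
  by apply/funext => y; rewrite derive1E; have h := df' y; rewrite derive_val.
by move=> /(elementary_derive e0)[f' _ df']; case: (df' x).
Qed.

Definition soft_positive_part v : R := v * flat 0 v.

Lemma is_derive_soft_positive_part v :
  is_derive v 1 soft_positive_part (v * flat 2 v + flat 0 v).
Proof.
have d1 : is_derive v 1 (flat 0) (flat 2 v).
  by apply: (is_derive_eq (is_derive_flat 0 v)); rewrite oppr0 mul0r add0r.
have d2 := is_deriveM (is_derive_id v (1 : R)) d1.
by apply: (is_derive_eq d2); rewrite /GRing.scale/= mulr1.
Qed.

(** With w = 1/v the derivative is (1 + w) exp(-w). *)
Lemma soft_positive_part_slope v : 0 <= v * flat 2 v + flat 0 v <= 1.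
Proof.
have [v0|v0] := leP v 0; first by rewrite !flat_le0// mulr0 addr0 lexx ler01.
rewrite !flat_gt0// invr1 mul1r.
have -> : v * (v ^- 2 * expR (- v^-1)) + expR (- v^-1) =
    (1 + v^-1) * expR (- v^-1) by field; rewrite gt_eqF.
have w0 : 0 < v^-1 by rewrite invr_gt0.
rewrite mulr_ge0 ?expR_ge0 ?addr_ge0 ?(ltW w0)//=.
by rewrite expRN ler_pdivrMr ?expR_gt0// mul1r expR_ge1Dx.
Qed.

Lemma soft_positive_part_lip v w :
  `|soft_positive_part v - soft_positive_part w| <= `|v - w|.
Proof.
wlog vw : v w / w < v.
  move=> H; have [h|h|->] := ltgtP v w; last by rewrite !subrr.
    by rewrite distrC [leRHS]distrC; exact: H.
  exact: H.
have cont : {within `[w, v], continuous soft_positive_part}.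
  apply: continuous_subspaceT => x; apply: differentiable_continuous.
  by apply/derivable1_diffP; case: (is_derive_soft_positive_part x).
have [c _ ->] := MVT vw (fun x _ => is_derive_soft_positive_part x) cont.
have /andP[h0 h1] := soft_positive_part_slope c.
by rewrite normrM ger0_norm// ler_piMl.
Qed.

Lemma soft_positive_part_le0 v : v <= 0 -> soft_positive_part v = 0.
Proof. by move=> v0; rewrite /soft_positive_part flat_le0// mulr0. Qed.

(** Since exp(-1/v) >= 1 - 1/v. *)
Lemma soft_positive_part_ge v : v - 1 <= soft_positive_part v.
Proof.
have [v0|v0] := leP v 0; first by rewrite soft_positive_part_le0//; lra.
rewrite /soft_positive_part flat_gt0// invr1 mul1r.
have -> : v - 1 = v * (1 - v^-1) by rewrite mulrBr mulr1 mulfV ?gt_eqF.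
by rewrite ler_wpM2l ?(ltW v0)//; exact: expR_ge1Dx.
Qed.

(** The logarithm of 1/|x|, smoothed at scale d. *)
Definition log_profile (d x : R) : R := - 2^-1 * ln (x ^+ 2 + d ^+ 2).

Definition moser (d x : R) : R := soft_positive_part (log_profile d x).

Lemma moser_smooth (l d k c : R) n x : 0 < d ->
  derivable (derive1n n (fun y => l * moser d (k * y + c))) x 1.
Proof.
move=> d0; apply: (@elementary_smooth (d ^+ 2)); first exact: exprn_gt0.
apply: elementary_mul; first exact: elementary_cst.
apply: (@elementary_comp _ (moser d) (fun y => k * y + c)); last first.
  apply: elementary_add; last exact: elementary_cst.
  by apply: elementary_mul; [exact: elementary_cst|exact: elementary_id].
apply: (@elementary_comp _ soft_positive_part (log_profile d)).
  by apply: elementary_mul; [exact: elementary_id|exact: elementary_flat].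
by apply: elementary_mul; [exact: elementary_cst|exact: elementary_ln].
Qed.

Lemma measurable_moser (d : R) : 0 < d -> measurable_fun setT (moser d).
Proof.
move=> d0; apply: continuous_measurable_fun => x.
apply: differentiable_continuous; apply/derivable1_diffP.
have := @moser_smooth 1 d 1 0 0 x d0.
by rewrite derive1n0; under eq_fun do rewrite !mul1r addr0.
Qed.

End SmoothBump.

(** * Pointwise estimates on the truncated logarithm *)

Section ProfileEstimates.
Context {R : realType}.
Implicit Types (d x y : R).

Let q_gt0 d x : 0 < d -> 0 < x ^+ 2 + d ^+ 2.
Proof. by move=> d0; rewrite ltr_wpDl ?sqr_ge0 ?exprn_gt0. Qed.

Lemma ln_half x : 0 < x -> 2^-1 * ln (x ^+ 2) = ln x.
Proof. by move=> x0; rewrite lnXn// -mulr_natr; field. Qed.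

Lemma log_profile_ratio d x y t : 0 < d -> 0 < t ->
  x ^+ 2 + d ^+ 2 <= (y ^+ 2 + d ^+ 2) * t ^+ 2 ->
  log_profile d y - log_profile d x <= ln t.
Proof.
move=> d0 t0 h; rewrite /log_profile.
have : ln (x ^+ 2 + d ^+ 2) <= ln ((y ^+ 2 + d ^+ 2) * t ^+ 2).
  by rewrite ler_ln ?posrE ?mulr_gt0 ?exprn_gt0 ?q_gt0.
rewrite lnM ?posrE ?exprn_gt0 ?q_gt0// -(ln_half t0); lra.
Qed.

(** The ratio of x^2 + d^2 to y^2 + d^2 lies between 1 and the ratio of x^2 to
    y^2. *)
Lemma log_profile_scale d x y : 0 < d -> x != 0 -> y != 0 ->
  `|log_profile d x - log_profile d y| <= `|ln `|x / y| |.
Proof.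
move=> d0 x0 y0; wlog xy : x y x0 y0 / `|y| <= `|x|.
  move=> H; have [h|h] := leP `|y| `|x|; first exact: H.
  rewrite distrC -[x / y]invf_div normfV lnV ?normrN; last first.
    by rewrite posrE normr_gt0 mulf_neq0 ?invr_neq0.
  exact/H/ltW.
have t1 : 1 <= `|x / y| by rewrite normrM normfV ler_pdivlMr ?mul1r ?normr_gt0.
have t0 : 0 < `|x / y| by exact: lt_le_trans t1.
have ly : 0 <= log_profile d y - log_profile d x.
  rewrite subr_ge0 /log_profile !mulNr lerN2 ler_wpM2l//.
  rewrite ler_ln ?posrE ?q_gt0// lerD2r -[y ^+ 2]real_normK ?num_real//.
  by rewrite -[x ^+ 2]real_normK ?num_real// ler_pXn2r ?nnegrE.
rewrite distrC ger0_norm// [leRHS]ger0_norm ?ln_ge0//.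
apply: log_profile_ratio => //.
rewrite real_normK ?num_real// exprMn exprVn mulrDl mulrCA mulfV ?expf_eq0/= ?(negbTE y0)//.
rewrite mulr1 lerD2l -[leLHS]mulr1 ler_wpM2l ?sqr_ge0//.
by rewrite -exprVn -exprMn -real_normK ?num_real// exprn_ege1.
Qed.

(** The function sqrt(x^2 + d^2) is 1-Lipschitz and at least d. *)
Lemma log_profile_lip d x y : 0 < d ->
  `|log_profile d x - log_profile d y| <= ln (1 + `|(x - y) / d|).
Proof.
move=> d0.
have main a b : log_profile d b - log_profile d a <= ln (1 + `|(a - b) / d|).
  set h := `|_|; have h0 : 0 <= h by exact: normr_ge0.
  apply: log_profile_ratio => //; first by rewrite ltr_pwDl.
  have hE : `|a - b| = h * d.
    by rewrite /h normrM normfV (gtr0_norm d0) divfK// gt_eqF.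
  have ab : `|a| <= `|b| + h * d by rewrite -hE -lerBlDl; exact: lerB_dist.
  have a2 : a ^+ 2 <= (`|b| + h * d) ^+ 2.
    rewrite -[a ^+ 2]real_normK ?num_real// ler_pXn2r ?nnegrE//.
    by rewrite addr_ge0// mulr_ge0// ltW.
  rewrite -[b ^+ 2]real_normK ?num_real//; set B := `|b| in a2 *.
  have B0 : 0 <= B by exact: normr_ge0.
  apply: (le_trans (lerD a2 (lexx _))).
  rewrite -subr_ge0.
  have -> : (B ^+ 2 + d ^+ 2) * (1 + h) ^+ 2 - ((B + h * d) ^+ 2 + d ^+ 2) =
    h * ((B - d) ^+ 2 + B ^+ 2 + d ^+ 2) + h ^+ 2 * B ^+ 2 by ring.
  by rewrite addr_ge0 ?mulr_ge0 ?addr_ge0 ?sqr_ge0.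
rewrite ler_norml; apply/andP; split; first by rewrite lerNl opprB; exact: main.
by have -> : `|(x - y) / d| = `|(y - x) / d| by rewrite !normrM distrC.
Qed.

Lemma log_profile_le d x : 0 < d -> x != 0 -> log_profile d x <= - ln `|x|.
Proof.
move=> d0 x0; rewrite /log_profile mulNr lerN2 -ln_half ?normr_gt0// ler_wpM2l//.
rewrite ler_ln ?posrE ?q_gt0 ?exprn_gt0 ?normr_gt0//.
by rewrite real_normK ?num_real// lerDl sqr_ge0.
Qed.

Lemma moser_eq0 d x : 0 < d -> 1 <= x ^+ 2 + d ^+ 2 -> moser d x = 0.
Proof.
move=> d0 x1; apply: soft_positive_part_le0.
by rewrite /log_profile mulNr oppr_le0 mulr_ge0// ln_ge0.
Qed.

Lemma moser_center d x : 0 < d -> `|x| <= d -> - ln d - 2 <= moser d x.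
Proof.
move=> d0 xd; apply: le_trans (soft_positive_part_ge _).
suff : - ln d - 1 <= log_profile d x by lra.
have h : x ^+ 2 + d ^+ 2 <= 2 * d ^+ 2.
  rewrite mulr_natl mulr2n lerD2r -[x ^+ 2]real_normK ?num_real//.
  by rewrite ler_pXn2r ?nnegrE// ltW.
have : ln (x ^+ 2 + d ^+ 2) <= ln (2 * d ^+ 2).
  by rewrite ler_ln ?posrE ?q_gt0 ?mulr_gt0 ?exprn_gt0.
rewrite lnM ?posrE ?exprn_gt0// -(ln_half d0) /log_profile.
have : ln (1 + 1 : R) <= 1 by apply: le_ln1Dx; lra.
by have -> : (1 + 1 : R) = 2 by []; lra.
Qed.

End ProfileEstimates.

(** * The energy near, around and far from the singularity *)

Section MoserEnergy.
Context {R : realType}.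
Local Notation mu := (@lebesgue_measure R).
Local Notation D := (`]0%R, +oo[%classic : set R).
Implicit Types (d p x y K : R).

(** At 0 the convention ln 0 = 0 breaks the pointwise estimates that involve
    ln |x|. *)
Lemma ge0_le_integral_off0 (f g : R -> R) :
  measurable_fun setT f -> measurable_fun setT g ->
  (forall x, 0 <= f x) -> (forall x, 0 <= g x) ->
  (forall x, x != 0 -> f x <= g x) ->
  (\int[mu]_x (f x)%:E <= \int[mu]_x (g x)%:E)%E.
Proof.
move=> mf mg f0 g0 fg; apply: ae_ge0_le_integral => //.
- by move=> x _; rewrite lee_fin.
- exact/measurable_EFinP.
- by move=> x _; rewrite lee_fin.
- exact/measurable_EFinP.
exists [set 0]; split => //; first exact: lebesgue_measure_set1.
move=> x /= h; apply: contrapT => x0; apply: h => _.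
by rewrite lee_fin fg//; apply/eqP.
Qed.

Lemma moser_diff_le d x y :
  `|moser d x - moser d y| <= `|log_profile d x - log_profile d y|.
Proof. exact: soft_positive_part_lip. Qed.

Definition inner_energy p d y : \bar R :=
  (\int[mu]_x (slobodeckij_integrand p (moser d) x y)%:E)%E.

(** Substitute x = r y. *)
Lemma inner_energy_scale p d y : 0 < d -> 0 < p -> y != 0 ->
  (inner_energy p d y <= `|y|^-1%:E * kappa p)%E.
Proof.
move=> d0 p0 y0; have mm := measurable_moser d0.
have Y0 : 0 < `|y| by rewrite normr_gt0.
rewrite /inner_energy (@ge0_integral_affine _ y 0) //; last 2 first.
- exact: measurable_slobodeckij_integrandl.
- by move=> x; rewrite lee_fin slobodeckij_integrand_ge0.
have mphi : measurable_fun setT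
    (fun r => slobodeckij_integrand p (moser d) (y * r + 0) y).
  have /measurable_EFinP m1 := measurable_slobodeckij_integrandl p y mm.
  exact: (measurableT_comp m1 (measurable_affine y 0)).
have ml := @measurable_log_kernel R p.
have h : (\int[mu]_r (slobodeckij_integrand p (moser d) (y * r + 0) y)%:E <=
    \int[mu]_r (`|y| ^- 2 * log_kernel p r)%:E)%E.
  apply: ge0_le_integral_off0 => //.
  - exact: measurable_funM.
  - by move=> r; exact: slobodeckij_integrand_ge0.
  - by move=> r; rewrite mulr_ge0 ?invr_ge0 ?exprn_ge0// log_kernel_ge0.
  move=> r r0; rewrite addr0 /slobodeckij_integrand /log_kernel.
  rewrite -[X in y * r - X]mulr1 -mulrBr normrM exprMn invfM [leLHS]mulrA.
  rewrite [leRHS]mulrA ler_wpM2r ?invr_ge0 ?exprn_ge0//.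
  rewrite [leLHS]mulrC ler_wpM2l ?invr_ge0 ?exprn_ge0//.
  apply: ge0_ler_powR; rewrite ?nnegrE ?(ltW p0)//.
  apply: (le_trans (moser_diff_le _ _ _)).
  have -> : ln `|r| = ln `|y * r / y| by rewrite mulrAC mulfV// mul1r.
  by apply: log_profile_scale => //; rewrite mulf_neq0.
apply: (@le_trans _ _ (`|y|%:E * \int[mu]_r (`|y| ^- 2 * log_kernel p r)%:E)%E).
  by apply: lee_wpmul2l => //; rewrite lee_fin ltW.
under eq_integral do rewrite EFinM.
rewrite ge0_integralZl_EFin ?invr_ge0 ?exprn_ge0//; last 2 first.
- by move=> x _; rewrite lee_fin log_kernel_ge0.
- exact/measurable_EFinP.
by rewrite muleA -EFinM expr2 invfM mulrA mulfV ?mul1r// ?normr_eq0.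
Qed.

(** Substitute x = d z + y.  The resulting bound ln(1 + |z|)^p / z^2 coincides
    with the logarithmic kernel at 1 + |z|, hence is integrable with the same
    constant kappa. *)
Lemma inner_energy_center p d y : 0 < d -> 0 < p ->
  (inner_energy p d y <= (2 / d)%:E * kappa p)%E.
Proof.
move=> d0 p0; have mm := measurable_moser d0.
have dn0 : d != 0 by rewrite gt_eqF.
rewrite /inner_energy (@ge0_integral_affine _ d y) //; last 2 first.
- exact: measurable_slobodeckij_integrandl.
- by move=> x; rewrite lee_fin slobodeckij_integrand_ge0.
have mphi : measurable_fun setT
    (fun z => (slobodeckij_integrand p (moser d) (d * z + y) y)%:E).
  have m1 := measurable_slobodeckij_integrandl p y mm.
  exact: (measurableT_comp m1 (measurable_affine d y)).
have ml (k : R) : measurable_fun setT (fun z : R => (log_kernel p (k * z + 1))%:E).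
  apply/measurable_EFinP.
  exact: (measurableT_comp (@measurable_log_kernel R p) (measurable_affine k 1)).
have mS : measurable_fun setT (fun z : R =>
    ((log_kernel p (1 * z + 1))%:E + (log_kernel p (-1 * z + 1))%:E)%E).
  by apply: emeasurable_funD; exact: ml.
have kap (k : R) : `|k| = 1 -> k != 0 ->
    (\int[mu]_z (log_kernel p (k * z + 1))%:E = kappa p)%E.
  move=> k1 k0; rewrite /kappa [RHS](@ge0_integral_affine _ k 1) ?k1 ?mul1e//.
    by apply/measurable_EFinP; exact: measurable_log_kernel.
  by move=> x; rewrite lee_fin log_kernel_ge0.
have h : (\int[mu]_z (slobodeckij_integrand p (moser d) (d * z + y) y)%:E <=
    \int[mu]_z ((d ^- 2)%:E * ((log_kernel p (1 * z + 1))%:E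
       + (log_kernel p (-1 * z + 1))%:E)))%E.
  apply: ge0_le_integral => //.
  - by move=> z _; rewrite lee_fin slobodeckij_integrand_ge0.
  - exact: measurable_funeM.
  move=> z _; rewrite -EFinD -EFinM lee_fin /slobodeckij_integrand addrK.
  rewrite normrM exprMn invfM (gtr0_norm d0) mulrCA ler_wpM2l ?invr_ge0 ?exprn_ge0 ?(ltW d0)//.
  have dz : `|moser d (d * z + y) - moser d y| <= ln (1 + `|z|).
    apply: (le_trans (moser_diff_le _ _ _)).
    apply: (le_trans (log_profile_lip _ _ d0)).
    by rewrite addrK mulrAC mulfV// mul1r.
  have l0 : 0 <= ln (1 + `|z|) by rewrite ln_ge0// lerDl.
  apply: (@le_trans _ _ ((ln (1 + `|z|)) `^ p / `|z| ^+ 2)).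
    rewrite ler_wpM2r ?invr_ge0 ?exprn_ge0//.
    by apply: ge0_ler_powR; rewrite ?nnegrE ?(ltW p0).
  (* The variable 1 + |z| is one of 1 + z and 1 - z; bounding by the sum of both
     kernels avoids cutting the integral. *)
  have [z0|z0] := leP 0 z.
    rewrite mul1r (ger0_norm z0) -[leLHS]addr0 lerD ?log_kernel_ge0//.
    rewrite /log_kernel addrK [z + 1]addrC (ger0_norm z0).
    by rewrite [`|1 + z|]ger0_norm ?addr_ge0// ger0_norm// -(ger0_norm z0).
  rewrite -[leLHS]add0r lerD ?log_kernel_ge0//.
  rewrite /log_kernel addrK mulN1r normrN [- z + 1]addrC (ltr0_norm z0).
  have z1 : 0 <= 1 - z by lra.
  by rewrite [`|1 - z|]ger0_norm// ger0_norm// -(ltr0_norm z0).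
apply: (@le_trans _ _ (`|d|%:E * \int[mu]_z ((d ^- 2)%:E *
    ((log_kernel p (1 * z + 1))%:E + (log_kernel p (-1 * z + 1))%:E)))%E).
  by apply: lee_wpmul2l => //; rewrite lee_fin.
rewrite ge0_integralZl_EFin ?invr_ge0 ?exprn_ge0 ?(ltW d0)//; last first.
  by move=> x _; rewrite adde_ge0// lee_fin log_kernel_ge0.
have lk0 (k : R) z : setT z -> (0 <= (log_kernel p (k * z + 1))%:E)%E.
  by move=> _; rewrite lee_fin log_kernel_ge0.
rewrite (ge0_integralD mu measurableT (lk0 1) (ml 1) (lk0 (-1)) (ml (-1))).
rewrite !kap ?normrN1 ?normr1 ?oppr_eq0 ?oner_eq0// (gtr0_norm d0) muleA -EFinM.
have -> : (kappa p + kappa p = 2%:E * kappa p)%E.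
  by rewrite -mule2n mule_natl.
rewrite muleA -EFinM.
have -> : d * d ^- 2 * 2 = 2 / d by field.
exact: lexx.
Qed.

(** The function vanishes at y, and the points x where it does not satisfy
    |x - y| >= |y|/2.  What remains is the integral of |ln |x||^p over
    |x| < 1, which the logarithmic kernel dominates up to the factor 4. *)
Lemma inner_energy_far p d y : 0 < d -> 0 < p -> 2 <= `|y| ->
  (inner_energy p d y <= (16 * `|y| ^- 2)%:E * kappa p)%E.
Proof.
move=> d0 p0 y2; have mm := measurable_moser d0.
have Y0 : 0 < `|y| by lra.
have ml := @measurable_log_kernel R p.
have lk0 z : setT z -> (0 <= (log_kernel p z)%:E)%E.
  by move=> _; rewrite lee_fin log_kernel_ge0.
have c0 : 0 <= 16 * `|y| ^- 2 by rewrite mulr_ge0// invr_ge0 exprn_ge0.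
have mlE : measurable_fun setT (EFin \o log_kernel p) by exact/measurable_EFinP.
rewrite /kappa -(ge0_integralZl_EFin mu measurableT lk0 mlE c0).
under [leRHS]eq_integral do rewrite -EFinM.
apply: ge0_le_integral_off0.
- by have /measurable_EFinP := measurable_slobodeckij_integrandl p y mm.
- exact: measurable_funM.
- by move=> x; exact: slobodeckij_integrand_ge0.
- by move=> x; rewrite !mulr_ge0 ?log_kernel_ge0// invr_ge0 exprn_ge0.
have big z : 1 <= `|z| -> moser d z = 0.
  move=> z1; apply: moser_eq0 => //.
  rewrite -[z ^+ 2]real_normK ?num_real//.
  have : 1 <= `|z| ^+ 2 by rewrite exprn_ege1.
  by have := sqr_ge0 d; lra.
move=> x x0; rewrite /slobodeckij_integrand (big y) ?subr0; last by lra.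
have [x1|x1] := leP 1 `|x|.
  rewrite (big x)// normr0 powR0 ?gt_eqF// mul0r.
  by rewrite !mulr_ge0 ?log_kernel_ge0// invr_ge0 exprn_ge0.
have ux : `|moser d x| `^ p <= `|ln `|x| | `^ p.
  apply: ge0_ler_powR; rewrite ?nnegrE ?(ltW p0)//.
  have X0 : 0 < `|x| by rewrite normr_gt0.
  have lx : 0 <= - ln `|x| by rewrite oppr_ge0 ln_le0// ltW.
  rewrite -[`|ln _|]normrN [leRHS]ger0_norm//.
  have [v0|v0] := leP (log_profile d x) 0.
    by rewrite /moser soft_positive_part_le0// normr0.
  have := soft_positive_part_lip (log_profile d x) 0.
  rewrite [soft_positive_part 0]soft_positive_part_le0// !subr0 => /le_trans; apply.
  by rewrite gtr0_norm//; exact: log_profile_le.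
have xy : `|y| / 2 <= `|x - y|.
  by have := lerB_dist y x; rewrite distrC; lra.
have xy2 : (`|y| / 2) ^+ 2 <= `|x - y| ^+ 2 by rewrite ler_pXn2r ?nnegrE// ltW// divr_gt0.
have x12 : `|x - 1| <= 2 by have := ler_normB x 1; rewrite normr1; lra.
have x1_0 : x - 1 != 0.
  by rewrite subr_eq0; apply: contraTN x1 => /eqP ->; rewrite normr1 ltxx.
have x14 : `|x - 1| ^+ 2 <= 4.
  have -> : (4 : R) = 2 ^+ 2 by ring.
  by rewrite ler_pXn2r ?nnegrE.
apply: (@le_trans _ _ (`|ln `|x| | `^ p * (4 * `|y| ^- 2))).
  rewrite ler_pM ?powR_ge0 ?invr_ge0 ?exprn_ge0//.
  have -> : 4 * `|y| ^- 2 = ((`|y| / 2) ^+ 2)^-1 by field; rewrite gt_eqF.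
  by rewrite lef_pV2 ?posrE ?exprn_gt0 ?divr_gt0//; apply: lt_le_trans xy; rewrite divr_gt0.
rewrite /log_kernel; set Z := `|x - 1| ^+ 2 in x14 *.
have Z0 : 0 < Z by rewrite exprn_gt0// normr_gt0.
have -> : 16 * `|y| ^- 2 * (`|ln `|x| | `^ p / Z) =
    `|ln `|x| | `^ p * (16 / Z * `|y| ^- 2) by ring.
rewrite ler_wpM2l ?powR_ge0// ler_wpM2r ?invr_ge0 ?exprn_ge0//.
by rewrite ler_pdivlMr//; lra.
Qed.

End MoserEnergy.

(** * The total energy of the truncated logarithm *)

Section MoserTotalEnergy.
Context {R : realType}.
Local Notation mu := (@lebesgue_measure R).
Local Notation D := (`]0%R, +oo[%classic : set R).
Implicit Types (d p x y K : R).

Lemma continuous_inv_gt0 (a : R) : 0 < a -> {for a, continuous (fun y : R => y^-1)}.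
Proof. by move=> a0; apply: inv_continuous; rewrite gt_eqF. Qed.

Lemma cvgr_inv_pinfty : (fun y : R => y^-1) @ +oo --> (0 : R).
Proof.
apply/cvgr0Pnorm_le => e e0; near=> y.
have ye : e^-1 <= y by near: y; apply: nbhs_pinfty_ge; exact: num_real.
have y0 : 0 < y by apply: lt_le_trans ye; rewrite invr_gt0.
by rewrite normfV gtr0_norm// -[e]invrK lef_pV2 ?posrE ?invr_gt0.
Unshelve. all: by end_near. Qed.

Lemma integral_inv_itv (K a b : R) : 0 < a -> a < b ->
  (\int[mu]_(y in `]a, b]) (K * y^-1)%:E = (K * (ln b - ln a))%:E)%E.
Proof.
move=> a0 ab.
have mK : measurable_fun `]a, b] (fun y : R => (K * y^-1)%:E).
  apply/measurable_EFinP/measurable_funM => //.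
  apply: subspace_continuous_measurable_fun => //.
  apply: continuous_in_subspaceT => y; rewrite inE/= in_itv/= => /andP[ay _].
  by apply: continuous_inv_gt0; exact: lt_trans ay.
rewrite integral_itv_obnd_cbnd//.
have dF y : 0 < y -> is_derive y 1 (fun y : R => K * ln y) (K * y^-1).
  move=> y0; have d1 := is_deriveM (is_derive_cst K y (1 : R)) (is_derive1_ln y0).
  by apply: (is_derive_eq d1); rewrite /GRing.scale/= mulr0 addr0.
rewrite (@continuous_FTC2 _ _ (fun y => K * ln y) a b)//.
- by rewrite -EFinB mulrBr.
- apply: continuous_in_subspaceT => y; rewrite inE/= in_itv/= => /andP[ay _].
  apply: continuousM; first exact: cst_continuous.
  by apply: continuous_inv_gt0; exact: lt_le_trans ay.
- have cF y : 0 < y -> {for y, continuous (fun y : R => K * ln y)}.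
    move=> y0; apply: differentiable_continuous; apply/derivable1_diffP.
    by case: (dF y y0).
  split.
  + by move=> y; rewrite in_itv/= => /andP[ay _]; case: (dF y (lt_trans a0 ay)).
  + by apply: cvg_at_right_filter; exact: cF.
  + by apply: cvg_at_left_filter; apply: cF; exact: lt_trans ab.
- move=> y; rewrite in_itv/= => /andP[ay _]; rewrite derive1E.
  by have := dF y (lt_trans a0 ay); move=> h; rewrite derive_val.
Qed.

Lemma continuous_inv_sqr (K y : R) : 0 < y ->
  {for y, continuous (fun y : R => K * y ^- 2)}.
Proof.
move=> y0; apply: continuousM; first exact: cst_continuous.
apply: continuousV; first by rewrite expf_eq0/= gt_eqF.
exact: exprn_continuous.
Qed.

Lemma integral_inv_sqr_itv (K a : R) : 0 <= K -> 0 < a ->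
  (\int[mu]_(y in `]a, +oo[) (K * y ^- 2)%:E = (K / a)%:E)%E.
Proof.
move=> K0 a0.
have cf y : 0 < y -> _ := @continuous_inv_sqr K y.
have mK : measurable_fun `]a, +oo[ (fun y : R => (K * y ^- 2)%:E).
  apply/measurable_EFinP.
  apply: subspace_continuous_measurable_fun => //.
  apply: continuous_in_subspaceT => y; rewrite inE/= in_itv/= andbT => ay.
  by apply: cf; exact: lt_trans ay.
rewrite integral_itv_obnd_cbnd//.
have dF y : 0 < y -> is_derive y 1 (fun y : R => - K * y^-1) (K * y ^- 2).
  move=> y0; have yn0 : y != 0 by rewrite gt_eqF.
  have d0 := @is_deriveV _ id y 1 1 yn0 (is_derive_id _ _).
  have d1 := is_deriveM (is_derive_cst (- K) y (1 : R)) d0.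
  by apply: (is_derive_eq d1); rewrite /GRing.scale/= mulr0 addr0 mulr1 mulrNN.
have cF y : 0 < y -> {for y, continuous (fun y : R => - K * y^-1)}.
  move=> y0; apply: differentiable_continuous; apply/derivable1_diffP.
  by case: (dF y y0).
rewrite (@ge0_continuous_FTC2y _ _ (fun y => - K * y^-1) a 0)//.
- by rewrite sub0e -EFinN mulNr opprK.
- by move=> y ay; rewrite mulr_ge0// invr_ge0 exprn_ge0// (le_trans (ltW a0)).
- apply: continuous_in_subspaceT => y; rewrite inE/= in_itv/= andbT => ay.
  by apply: cf; exact: lt_le_trans ay.
- rewrite -[X in _ --> X](mulr0 (- K)); apply: cvgM; first exact: cvg_cst.
  exact: cvgr_inv_pinfty.
- by move=> y ay; case: (dF y (lt_trans a0 ay)).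
- by apply: cvg_at_right_filter; exact: cF.
- move=> y; rewrite in_itv/= andbT => ay; rewrite derive1E.
  by have := dF y (lt_trans a0 ay); move=> h; rewrite derive_val.
Qed.

(** The pieces are the scales below the truncation, the logarithmic range, and
    the region away from the support. *)
Lemma integral_split3 (f : R -> \bar R) (d : R) : 0 < d -> d < 2 ->
  measurable_fun setT f -> (forall x, 0 <= f x)%E ->
  (\int[mu]_(x in D) f x = \int[mu]_(x in `]0%R, d]) f x +
    (\int[mu]_(x in `]d, 2%R]) f x + \int[mu]_(x in `]2%R, +oo[) f x))%E.
Proof.
move=> d0 d2 mf f0.
have -> : D = `]0%R, d]%classic `|` (`]d, 2%R]%classic `|` `]2%R, +oo[%classic).
  apply/seteqP; split => x /=; rewrite !in_itv/= !andbT.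
    move=> x0; have [h|h] := leP x d; first by left; rewrite x0.
    by right; have [h'|h'] := leP x 2; [left|right].
  move=> [/andP[]//|[/andP[h _]|h]]; first exact: lt_trans h.
  by apply: lt_trans h.
rewrite ge0_integral_setU//; last 3 first.
- exact: measurableU.
- exact: measurable_funTS.
- rewrite disj_set2E; apply/eqP/seteqP; split => // x [] /=.
  rewrite !in_itv/= !andbT => /andP[_ h] [/andP[h' _]|h'].
    by move: h'; rewrite ltNge h.
  by move: (lt_trans d2 h'); rewrite ltNge h.
rewrite ge0_integral_setU//.
- exact: measurable_funTS.
- rewrite disj_set2E; apply/eqP/seteqP; split => // x [] /=.
  by rewrite !in_itv/= !andbT => /andP[_ h]; rewrite ltNge h.
Qed.

(** The middle piece contributes at most gamma_s (ln 2 - ln d), the leading term; the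
    two others are bounded by multiples of gamma_s that do not depend on d. *)
Theorem moser_energy_le p d : 1 < p -> 0 < d -> d < 1 ->
  (energy p (moser d) <= (gamma_s p * (- ln d + 11))%:E)%E.
Proof.
move=> p1 d0 d1; have p0 : 0 < p by lra.
pose K := gamma_s p / 2.
have kK : kappa p = K%:E by exact: kappa_gamma_s.
have K0 : 0 <= K.
  rewrite -lee_fin -kK; apply: integral_ge0 => x _.
  by rewrite lee_fin log_kernel_ge0.
pose E y := inner_energy p d y.
have E0 y : (0 <= E y)%E.
  by apply: integral_ge0 => x _; rewrite lee_fin slobodeckij_integrand_ge0.
have mE : measurable_fun setT E.
  by apply: measurable_inner_energy; exact: measurable_moser.
have mEN : measurable_fun setT (fun y => E (- y)) by exact: measurableT_comp.
have -> : energy p (moser d) = (\int[mu]_y E y)%E by [].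
rewrite integral_even_split// (@integral_split3 _ d)//; last 3 first.
- by lra.
- exact: emeasurable_funD.
- by move=> x; rewrite adde_ge0.
pose S y := (E y + E (- y)%R)%E.
have mS : measurable_fun setT S by exact: emeasurable_funD.
have S0 y : (0 <= S y)%E by rewrite adde_ge0.
have bnd y c : (E y <= (c * K)%:E)%E -> (E (- y)%R <= (c * K)%:E)%E ->
    (S y <= (2 * c * K)%:E)%E.
  move=> h1 h2; apply: (le_trans (leeD h1 h2)).
  by rewrite -EFinD lee_fin; lra.
have b1 : (\int[mu]_(y in `]0%R, d]) S y <= (4 * K)%:E)%E.
  apply: (@le_trans _ _ (\int[mu]_(y in `]0%R, d]) (2 * (2 / d) * K)%:E)%E).
    apply: ge0_le_integral => //; first exact: measurable_funTS.
    move=> y _; apply: bnd; rewrite EFinM -kK; exact: inner_energy_center.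
  have muI : mu `]0, d]%classic = d%:E.
    by rewrite lebesgue_measure_itv/= lte_fin d0 sube0.
  rewrite integral_cst// [X in (_ * X)%E](_ : _ = d%:E) // -EFinM lee_fin.
  by rewrite le_eqVlt; apply/orP; left; apply/eqP; field; rewrite gt_eqF.
have b2 : (\int[mu]_(y in `]d, 2%R]) S y <= (2 * K * (1 - ln d))%:E)%E.
  apply: (@le_trans _ _ (\int[mu]_(y in `]d, 2%R]) (2 * K * y^-1)%:E)%E).
    apply: ge0_le_integral => //.
    - exact: measurable_funTS.
    - apply/measurable_EFinP/measurable_funM => //.
      apply: subspace_continuous_measurable_fun => //.
      apply: continuous_in_subspaceT => y; rewrite inE/= in_itv/= => /andP[ay _].
      by apply: continuous_inv_gt0; exact: lt_trans ay.
    move=> y /=; rewrite in_itv/= => /andP[dy _].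
    have y0 : 0 < y by exact: lt_trans dy.
    have -> : 2 * K * y^-1 = 2 * y^-1 * K by ring.
    have h z : `|z| = y -> (E z <= (y^-1 * K)%:E)%E.
      move=> zy; rewrite EFinM -kK -zy; apply: inner_energy_scale => //.
      by rewrite -normr_eq0 zy gt_eqF.
    by apply: bnd; apply: h; rewrite ?normrN gtr0_norm.
  rewrite integral_inv_itv//; last by lra.
  have l2 : ln (2 : R) <= 1 by apply: (@le_ln1Dx R 1); lra.
  rewrite lee_fin; apply: ler_wpM2l; first by rewrite mulr_ge0.
  by rewrite lerD2r.
have b3 : (\int[mu]_(y in `]2%R, +oo[) S y <= (16 * K)%:E)%E.
  apply: (@le_trans _ _ (\int[mu]_(y in `]2%R, +oo[) (32 * K * y ^- 2)%:E)%E).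
    apply: ge0_le_integral => //.
    - exact: measurable_funTS.
    - apply/measurable_EFinP; apply: subspace_continuous_measurable_fun => //.
      apply: continuous_in_subspaceT => y; rewrite inE/= in_itv/= andbT => ay.
      by apply: continuous_inv_sqr; exact: lt_trans ay.
    move=> y /=; rewrite in_itv/= andbT => y2.
    have y0 : 0 < y by exact: lt_trans y2.
    have -> : 32 * K * y ^- 2 = 2 * (16 * y ^- 2) * K by ring.
    have h z : `|z| = y -> (E z <= (16 * y ^- 2 * K)%:E)%E.
      move=> zy; rewrite EFinM -kK -zy; apply: inner_energy_far => //.
      by rewrite zy ltW.
    by apply: bnd; apply: h; rewrite ?normrN gtr0_norm.
  have K32 : 0 <= 32 * K by apply: mulr_ge0.
  rewrite integral_inv_sqr_itv//.
  by rewrite lee_fin le_eqVlt; apply/orP; left; apply/eqP; field.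
apply: (le_trans (leeD b1 (leeD b2 b3))).
rewrite -!EFinD lee_fin /K.
by rewrite le_eqVlt; apply/orP; left; apply/eqP; field.
Qed.

End MoserTotalEnergy.

(** * Blow-up above the critical exponent *)

Section Supercritical.
Context {R : realType}.
Local Notation mu := (@lebesgue_measure R).
Implicit Types (p l k c d x y : R) (v : R -> R).

Lemma ge0_integral_affine_comp k c (f : R -> \bar R) : k != 0 ->
  measurable_fun setT f -> (forall x, 0 <= f x)%E ->
  (\int[mu]_x f (k * x + c)%R = `|k|^-1%:E * \int[mu]_x f x)%E.
Proof.
move=> k0 mf f0; rewrite [in RHS](ge0_integral_affine c k0 mf f0) muleA -EFinM.
by rewrite mulVf ?normr_eq0// mul1e.
Qed.

(** The critical case s p = 1 is the one in which the kernel |x - y|^-2 makes the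
    energy invariant under affine changes of the variable. *)
Lemma energy_affine p l k c v : k != 0 -> measurable_fun setT v ->
  energy p (fun x => l * v (k * x + c)) = ((`|l| `^ p)%:E * energy p v)%E.
Proof.
move=> k0 mv.
have k20 : 0 <= `|k| ^+ 2 by exact: exprn_ge0.
have lk0 : 0 <= `|l| `^ p * `|k| ^+ 2 by rewrite mulr_ge0// powR_ge0.
have F0 x y : (0 <= (slobodeckij_integrand p v x y)%:E)%E.
  by rewrite lee_fin slobodeckij_integrand_ge0.
have mF y := measurable_slobodeckij_integrandl p y mv.
have mI := measurable_inner_energy p mv.
have slobE x y : (slobodeckij_integrand p (fun x => l * v (k * x + c)) x y)%:E =
    ((`|l| `^ p * `|k| ^+ 2)%:E *
      (slobodeckij_integrand p v (k * x + c) (k * y + c))%:E)%E.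
  rewrite /slobodeckij_integrand -EFinM; congr EFin.
  rewrite -mulrBr normrM powRM//.
  have -> : k * x + c - (k * y + c) = k * (x - y) by ring.
  rewrite normrM exprMn [(`|k| ^+ 2 * _)^-1]invfM.
  have kV : `|k| ^+ 2 * `|k| ^- 2 = 1 by rewrite mulfV// expf_eq0/= normr_eq0.
  move: kV; set A := `|l| `^ p; set V := _ `^ p; set K2 := `|k| ^+ 2.
  set Z := (`|x - y| ^+ 2)^-1; move: K2^-1 => K' kV.
  have -> : A * K2 * (V * (K' * Z)) = A * V * Z * (K2 * K') by ring.
  by rewrite kV mulr1.
have inner y : (\int[mu]_x (slobodeckij_integrand p (fun x => l * v (k * x + c)) x y)%:E =
    (`|l| `^ p * `|k|)%:E *
      \int[mu]_x (slobodeckij_integrand p v x (k * y + c))%:E)%E.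
  under eq_integral do rewrite slobE.
  have mFc : measurable_fun setT
      (fun x => (slobodeckij_integrand p v (k * x + c) (k * y + c))%:E).
    exact: (measurableT_comp (mF (k * y + c)) (measurable_affine k c)).
  rewrite (ge0_integralZl_EFin mu measurableT (fun x _ => F0 _ _) mFc lk0).
  rewrite (ge0_integral_affine_comp c k0 (mF _) (fun x => F0 x _)) muleA -EFinM.
  by rewrite expr2 mulrA mulfK ?normr_eq0.
have I0 y : (0 <= \int[mu]_x (slobodeckij_integrand p v x y)%:E)%E.
  by apply: integral_ge0 => x _; exact: F0.
have mIc : measurable_fun setT
    (fun y => \int[mu]_x (slobodeckij_integrand p v x (k * y + c))%:E)%E.
  exact: (measurableT_comp mI (measurable_affine k c)).
have lk1 : 0 <= `|l| `^ p * `|k| by rewrite mulr_ge0// powR_ge0.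
rewrite /energy; under eq_integral do rewrite inner.
rewrite (ge0_integralZl_EFin mu measurableT (fun y _ => I0 _) mIc lk1).
rewrite (ge0_integral_affine_comp c k0 mI I0) muleA -EFinM.
by rewrite mulfK ?normr_eq0.
Qed.

Lemma moser_ge0 d x : 0 <= moser d x.
Proof.
rewrite /moser; set w := log_profile d x.
have [w0|w0] := leP w 0; first by rewrite soft_positive_part_le0.
by rewrite /soft_positive_part mulr_ge0 ?(ltW w0)// flat_gt0//
  mulr_ge0 ?expR_ge0// invr_ge0 exprn_ge0// ltW.
Qed.

Lemma moser_le d x : 0 < d -> d < 1 -> moser d x <= - ln d.
Proof.
move=> d0 d1; have ld : 0 <= - ln d by rewrite oppr_ge0 ln_le0// ltW.
have [w0|w0] := leP (log_profile d x) 0.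
  by rewrite /moser soft_positive_part_le0.
apply: (le_trans (ler_norm _)).
have := soft_positive_part_lip (log_profile d x) 0.
rewrite [soft_positive_part 0]soft_positive_part_le0// !subr0 => /le_trans; apply.
rewrite gtr0_norm// /log_profile mulNr lerN2 -ln_half// ler_wpM2l//.
by rewrite ler_ln ?posrE ?exprn_gt0 ?ltr_wpDl ?sqr_ge0 ?exprn_gt0// lerDr sqr_ge0.
Qed.

(** The truncated logarithm transported to the interval from a to b by the
    affine map onto (-1, 1), and scaled by l. *)
Definition moser_itv l d (a b x : R) : R :=
  l * moser d ((2 / (b - a)) * x + - (a + b) / (b - a)).

Section FixedInterval.
Variables (a b : R).
Hypothesis ab : a < b.

Let ba : 0 < b - a. Proof. by rewrite subr_gt0. Qed.

Let coord x : (2 / (b - a)) * x + - (a + b) / (b - a) =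
  (x - (a + b) / 2) / ((b - a) / 2).
Proof. by field; rewrite gt_eqF. Qed.

Let r d := (1 - d ^+ 2 / 2) * ((b - a) / 2).

Let support_itv l d : 0 < d -> d < 1 ->
  [set x | moser_itv l d a b x != 0] `<=`
  `[(a + b) / 2 - r d, (a + b) / 2 + r d]%classic.
Proof.
move=> d0 d1 x /=; rewrite /moser_itv coord in_itv/= mulf_eq0 negb_or => /andP[_].
set t := _ / ((b - a) / 2) => ht.
have t1 : t ^+ 2 + d ^+ 2 < 1.
  by rewrite ltNge; apply: contra ht => h; rewrite moser_eq0.
have h2 : 0 < d ^+ 2 by exact: exprn_gt0.
have d2 : d ^+ 2 < 1 by rewrite exprn_ilt1// ltW.
have t2 : `|t| <= 1 - d ^+ 2 / 2.
  have h0 : 0 <= 1 - d ^+ 2 / 2 by lra.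
  rewrite -(ler_pXn2r (_ : (0 < 2)%N)) ?nnegrE// real_normK ?num_real//.
  have := sqr_ge0 (d ^+ 2 / 2); set e := d ^+ 2 in t1 *; rewrite !expr2 in t1 *; nra.
have -> : x = (a + b) / 2 + t * ((b - a) / 2).
  by rewrite /t divfK ?gt_eqF ?divr_gt0//; ring.
move: t2; rewrite ler_norml => /andP[t2 t3]; rewrite !lerD2l /r -mulNr.
by rewrite !ler_pM2r ?divr_gt0// t2 t3.
Qed.

Let itv_sub d : 0 < d -> d < 1 ->
  `[(a + b) / 2 - r d, (a + b) / 2 + r d]%classic `<=` `]a, b[%classic.
Proof.
move=> d0 d1 x /=; rewrite !in_itv/= => /andP[h1 h2].
have h3 : 0 < d ^+ 2 * (b - a) by rewrite mulr_gt0// exprn_gt0.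
have rE : r d = (b - a) / 2 - d ^+ 2 * (b - a) / 4 by rewrite /r; field.
rewrite rE in h1 h2; apply/andP; split; lra.
Qed.

Lemma moser_itv_test l d : 0 < d -> d < 1 ->
  test_function `]a, b[ (moser_itv l d a b).
Proof.
move=> d0 d1; set J := `[(a + b) / 2 - r d, (a + b) / 2 + r d]%classic.
have cJ : closure [set x | moser_itv l d a b x != 0] `<=` J.
  have cl : closed J by exact: interval_closed.
  by rewrite [J]((closure_id J).1 cl); apply: closure_subset; exact: support_itv.
split; first by move=> n x; exact: moser_smooth.
split; last exact: subset_trans cJ (itv_sub d0 d1).
apply: (subclosed_compact _ (@segment_compact _ _ _) cJ).
exact: closed_closure.
Qed.

Lemma measurable_moser_itv l d : 0 < d -> d < 1 ->
  measurable_fun setT (moser_itv l d a b).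
Proof.
move=> d0 d1; apply: continuous_measurable_fun.
exact: (test_function_continuous (moser_itv_test l d0 d1)).
Qed.

Lemma moser_itv_Lfun p l d : 1 < p -> 0 < d -> d < 1 -> 0 <= l ->
  moser_itv l d a b \in Lfun mu p%:E.
Proof.
move=> p1 d0 d1 l0; have p0 : 0 < p by lra.
have mm := measurable_moser_itv l d0 d1.
rewrite inE; apply/andP; split; first by rewrite inE.
rewrite inE/= /finite_norm unlock; apply: poweR_lty.
rewrite -[X in (X < _)%E]/(\int[mu]_x (`|moser_itv l d a b x| `^ p)%:E)%E.
pose C := (l * - ln d) `^ p.
have mI : measurable (`]a, b[%classic : set R) by exact: measurable_itv.
have m1 := measurable_indic_setT mI.
apply: (@le_lt_trans _ _ (\int[mu]_x (C * \1_(`]a, b[%classic) x)%:E)%E).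
  apply: ge0_le_integral => //.
  - apply/measurable_EFinP; apply: (measurableT_comp (measurable_powR p)).
    exact: measurable_norm_comp.
  - by apply/measurable_EFinP; exact: measurable_funM.
  move=> x _; rewrite /= lee_fin indicE.
  have [xI|xI] := pselect (`]a, b[%classic x).
    rewrite mem_set// mulr1 /C; apply: ge0_ler_powR; rewrite ?nnegrE ?(ltW p0)//.
      by rewrite mulr_ge0// oppr_ge0 ln_le0// ltW.
    rewrite /moser_itv normrM (ger0_norm l0) ger0_norm ?moser_ge0//.
    by rewrite ler_wpM2l// moser_le.
  rewrite (test_function_eq0 (moser_itv_test l d0 d1) xI).
  by rewrite normr0 powR0 ?gt_eqF// mulr_ge0// powR_ge0.
under eq_integral do rewrite EFinM.
rewrite ge0_integralZl_EFin ?powR_ge0//; last first.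
  exact/measurable_EFinP.
rewrite [X in (_ * X)%E](_ : _ = (b - a)%:E); first by rewrite -EFinM ltry.
rewrite [LHS](integral_indic_setT _)//.
by rewrite lebesgue_measure_itv/= lte_fin ab -EFinD.
Qed.

Lemma moser_itv_sobolev0 p l d : 1 < p -> 0 < d -> d < 1 -> 0 <= l ->
  (gagliardo p (moser_itv l d a b) < +oo)%E ->
  sobolev0 p `]a, b[ (moser_itv l d a b).
Proof.
move=> p1 d0 d1 l0 hg; have p0 : 0 < p by lra.
split; first by split => //; exact: moser_itv_Lfun.
move=> e e0; exists (moser_itv l d a b); first exact: moser_itv_test.
have -> : (moser_itv l d a b \- moser_itv l d a b)%R = cst 0.
  by apply/funext => x /=; rewrite subrr.
have g0 : gagliardo p (cst 0) = 0%E :> \bar R.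
  rewrite /gagliardo; under eq_integral => y _.
    under eq_integral => x _ do rewrite subrr normr0 powR0 ?gt_eqF// mul0r.
    rewrite integral0; over.
  by rewrite integral0 poweR0r// invr_neq0// gt_eqF.
have n0 : ('N[mu]_p%:E[EFin \o cst 0%R] = 0)%E.
  by have := @Lnorm0 _ _ _ mu p%:E; apply; rewrite eqe gt_eqF.
rewrite /sobolev_norm g0 n0 poweR0r ?gt_eqF// adde0 poweR0r ?lte_fin//.
by rewrite invr_neq0// gt_eqF.
Qed.

Lemma moser_itv_energy p l d : 1 < p -> 0 < d -> d < 1 ->
  (energy p (moser_itv l d a b) <= (`|l| `^ p * (gamma_s p * (- ln d + 11)))%:E)%E.
Proof.
move=> p1 d0 d1; rewrite energy_affine; last 2 first.
- by rewrite mulf_neq0// invr_neq0// gt_eqF.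
- exact: measurable_moser.
rewrite EFinM; apply: lee_wpmul2l; first by rewrite lee_fin powR_ge0.
exact: moser_energy_le.
Qed.

Lemma exp_integral_moser_ge (alpha q l d : R) : 0 < d -> d < 1 ->
  0 <= l -> 0 <= alpha -> 0 <= q -> 0 <= - ln d - 2 ->
  ((d * (b - a) / 2 * expR (alpha * (l * (- ln d - 2)) `^ q))%:E <=
   \int[mu]_(x in `]a, b[) (expR (alpha * `|moser_itv l d a b x| `^ q))%:E)%E.
Proof.
move=> d0 d1 l0 a0 q0 ld.
pose m := (a + b) / 2.
pose J : set R := `[m, m + d * (b - a) / 2]%classic.
have db : 0 < d * (b - a) by rewrite mulr_gt0.
have db1 : d * (b - a) < b - a by rewrite gtr_pMl.
have JI : J `<=` `]a, b[%classic.
  move=> x; rewrite /J/= !in_itv/= /m => /andP[h1 h2]; apply/andP; split; lra.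
have mJ : measurable J by exact: measurable_itv.
have muJ : mu J = (d * (b - a) / 2)%:E.
  rewrite lebesgue_measure_itv/= lte_fin ltrDl divr_gt0// -EFinB.
  by congr EFin; ring.
have mE : measurable_fun setT
    (fun x : R => (expR (alpha * `|moser_itv l d a b x| `^ q))%:E).
  apply/measurable_EFinP; apply: measurableT_comp => //.
  apply: measurable_funM => //; apply: (measurableT_comp (measurable_powR q)).
  by apply: measurable_norm_comp; exact: measurable_moser_itv.
set C := expR (alpha * (l * (- ln d - 2)) `^ q).
apply: (@le_trans _ _ (\int[mu]_(x in J) C%:E)%E).
  rewrite integral_cst// [X in (_ <= _ * X)%E](_ : _ = (d * (b - a) / 2)%:E)//.
  by rewrite -EFinM lee_fin [leRHS]mulrC.
apply: (@le_trans _ _ (\int[mu]_(x in J)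
    (expR (alpha * `|moser_itv l d a b x| `^ q))%:E)%E).
  apply: ge0_le_integral => //.
  - by move=> x _; rewrite lee_fin expR_ge0.
  - exact: measurable_funTS.
  move=> x; rewrite /J/= in_itv/= => /andP[h1 h2].
  rewrite lee_fin ler_expR ler_wpM2l//.
  apply: ge0_ler_powR; rewrite ?nnegrE// ?mulr_ge0//.
  apply: le_trans (ler_norm _); rewrite /moser_itv coord ler_wpM2l//.
  apply: moser_center => //; rewrite ger0_norm.
    by rewrite ler_pdivrMr ?divr_gt0// mulrA lerBlDl.
  by rewrite divr_ge0 ?subr_ge0// divr_ge0// ltW.
apply: ge0_subset_integral => //.
exact: measurable_funTS.
Qed.

End FixedInterval.

(** Any g' strictly between gamma_s and alpha^((1-s)/s) leaves room for the
    bounded part of the energy, once the height M is large, and still satisfies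
    alpha / g'^(s/(1-s)) = 1 + eta with eta > 0. *)
Theorem supercritical_infinite (s p : R) : 0 < s -> s < 1 -> 1 < p -> s * p = 1 ->
  forall a b : R, a < b ->
  forall alpha : R, alpha_upper s p < alpha ->
    moser_trudinger_sup s p alpha `]a, b[ = +oo%E.
Proof.
move=> s0 s1 p1 sp a b ab alpha; rewrite /alpha_upper; set g := gamma_s p => al.
have p0 : 0 < p by lra.
have ba : 0 < b - a by rewrite subr_gt0.
set sg := s / (1 - s) in al.
have sg0 : 0 < sg by rewrite divr_gt0// subr_gt0.
have g0 : 0 <= g.
  have : (0 <= kappa p)%E.
    by apply: integral_ge0 => x _; rewrite lee_fin log_kernel_ge0.
  by rewrite kappa_gamma_s// lee_fin /g; lra.
have al0 : 0 < alpha by apply: le_lt_trans al; exact: powR_ge0.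
pose be := alpha `^ sg^-1.
have gbe : g < be.
  have h : g = (g `^ sg) `^ sg^-1 by rewrite -powRrM mulfV ?gt_eqF// powRr1.
  by rewrite h; apply: gt0_ltr_powR; rewrite ?nnegrE ?powR_ge0 ?invr_gt0// ltW.
pose g' := (g + be) / 2.
have gg' : g < g' by rewrite /g'; lra.
have g'0 : 0 < g' by exact: le_lt_trans gg'.
have g'be : g' < be by rewrite /g'; lra.
have g'al : g' `^ sg < alpha.
  have h : alpha = be `^ sg by rewrite /be -powRrM mulVf ?gt_eqF// powRr1// ltW.
  by rewrite h; apply: gt0_ltr_powR; rewrite ?nnegrE ?powR_ge0// ltW.
pose eta := alpha / g' `^ sg - 1.
have w0 : 0 < g' `^ sg by exact: powR_gt0.
have eta0 : 0 < eta by rewrite subr_gt0 ltr_pdivlMr// mul1r.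
apply/eqyP => A A0.
pose B := A * 2 * expR 2 / (b - a).
have B0 : 0 < B by rewrite !(divr_gt0, mulr_gt0)// expR_gt0.
(* The second term makes g (M + 13) <= g' M, so that the energy is at most 1;
   the third one makes eta M >= B, so that the integral reaches A. *)
pose M := 1 + 13 * g / (g' - g) + B / eta.
have e1 : 0 <= 13 * g / (g' - g).
  by apply: divr_ge0; [exact: mulr_ge0|rewrite subr_ge0 ltW].
have e2 : 0 < B / eta by rewrite divr_gt0.
have M0 : 0 < M by rewrite /M; lra.
have gM : g * (M + 13) <= g' * M.
  have : 13 * g <= M * (g' - g).
    by rewrite -ler_pdivrMr ?subr_gt0// /M; lra.
  by lra.
have etaM : B <= eta * M.
  by rewrite mulrC -ler_pdivrMr// /M; lra.
(* The value of the truncated logarithm near 0 is at least - ln d - 2 = M. *)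
pose d := expR (- (M + 2)).
have d0 : 0 < d by exact: expR_gt0.
have d1 : d < 1 by rewrite expR_lt1; lra.
have lnd : - ln d = M + 2 by rewrite /d expRK opprK.
have gM0 : 0 < g' * M by exact: mulr_gt0.
pose l := (g' * M) `^ (- s).
have l0 : 0 < l by rewrite powR_gt0.
have ls : p^-1 = s.
  by apply: (mulIf (lt0r_neq0 p0)); rewrite mulVf ?gt_eqF// sp.
have lp : l `^ p = (g' * M)^-1.
  by rewrite /l -powRrM mulNr sp powR_inv1// mulr_ge0// ltW.
pose u := moser_itv l d a b.
have Eu : (energy p u <= 1)%E.
  apply: (le_trans (moser_itv_energy ab l p1 d0 d1)).
  rewrite lee_fin (gtr0_norm l0) lp lnd -/g ler_pdivrMl//.
  rewrite [leRHS]mulr1 (_ : M + 2 + 11 = M + 13)//; ring.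
have gu : (gagliardo p u <= 1)%E by rewrite gagliardo_le1.
have hu : sobolev0 p `]a, b[ u.
  apply: moser_itv_sobolev0 => //; first exact: ltW.
  by apply: (le_lt_trans gu); exact: ltry.
apply: (@le_trans _ _ (\int[mu]_(x in `]a, b[)
    (expR (alpha * `|u x| `^ (1 / (1 - s))))%:E)%E); last first.
  by apply: ereal_sup_ubound; exists u.
have r0 : 0 < 1 / (1 - s) by rewrite divr_gt0// subr_gt0.
have ld : - ln d - 2 = M by rewrite lnd addrK.
have := @exp_integral_moser_ge a b ab alpha (1 / (1 - s)) l d d0 d1 (ltW l0)
  (ltW al0) (ltW r0).
rewrite ld => /(_ (ltW M0)); apply: le_trans; rewrite lee_fin.
have s1n : 1 - s != 0 by rewrite gt_eqF// subr_gt0.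
have -> : (l * M) `^ (1 / (1 - s)) = M / g' `^ sg.
  have -> : l * M = g' `^ (- s) * M `^ (1 - s).
    rewrite /l (powRM _ (ltW g'0) (ltW M0)) -mulrA; congr (_ * _).
    rewrite [1 - s]addrC powRD ?(gt_eqF M0) ?implybT//.
    by rewrite (powRr1 (ltW M0)).
  rewrite powRM ?powR_ge0// -!powRrM mulrC.
  have -> : (1 - s) * (1 / (1 - s)) = 1 by rewrite mul1r mulfV.
  rewrite (powRr1 (ltW M0)); congr (_ * _).
  by rewrite -powRN; congr (_ `^ _); rewrite /sg; field.
have -> : alpha * (M / g' `^ sg) = M + eta * M.
  by rewrite /eta; field; rewrite gt_eqF.
have -> : d = expR (- M) / expR 2 by rewrite /d opprD expRD expRN [expR (- (2))]expRN.
rewrite (expRD M).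
have -> : expR (- M) / expR 2 * (b - a) / 2 * (expR M * expR (eta * M)) =
   (b - a) / (2 * expR 2) * expR (eta * M).
  have eM : expR M != 0 by rewrite gt_eqF// expR_gt0.
  have e2' : expR 2 != 0 :> R by rewrite gt_eqF// expR_gt0.
  by rewrite expRN; field; rewrite eM e2'.
rewrite mulrC -ler_pdivrMr ?divr_gt0 ?mulr_gt0 ?expR_gt0//.
have -> : A / ((b - a) / (2 * expR 2)) = B.
  have e2' : expR 2 != 0 :> R by rewrite gt_eqF// expR_gt0.
  by rewrite /B; field; rewrite e2' gt_eqF.
apply: (le_trans etaM); apply: le_trans (expR_ge1Dx _); by rewrite lerDr.
Qed.

End Supercritical.

(** * The Moser-Trudinger threshold *)

Unset Implicit Arguments.

Theorem theorem1p1 (R : realType) (s p : R)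
    (hs0 : 0 < s) (hs1 : s < 1) (hp : 1 < p) (hsp : s * p = 1) :
  (exists alpha_lower : R, 0 < alpha_lower /\
     forall a b : R, a < b ->
     forall alpha : R, 0 <= alpha -> alpha < alpha_lower ->
       (moser_trudinger_sup s p alpha `]a, b[ < +oo)%E) /\
  (forall a b : R, a < b ->
   forall alpha : R, alpha_upper s p < alpha ->
     moser_trudinger_sup s p alpha `]a, b[ = +oo%E).
Proof.
split; first exact: subcritical_finite.
by move=> a b ab alpha; exact: supercritical_infinite.
Qed.
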